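(* The relations $G_{s(\mathbb{G}_0)}$ and $s(\mathbb{T}_0)$ on $2^\omega$ are each $\sqsubseteq_c$-minimal among non-pot$(\Pi^0_1)$ relations.
   Context: Let $\psi:\omega\to2^{<\omega}$ list finite binary sequences by increasing length and lexicographically within each length, $s_n:=\psi(n)0^{n-|\psi(n)|}$, $\mathbb{G}_0:=\{(s_n0\gamma,s_n1\gamma)\mid n\in\omega,\gamma\in2^\omega\}$, $s(A):=A\cup A^{-1}$, $G_{s(\mathbb{G}_0)}:=\{(0\alpha,1\beta)\mid(\alpha,\beta)\in s(\mathbb{G}_0)\}$, $\mathbb{T}_0:=\{(\varepsilon\alpha,(1-\varepsilon)\beta)\mid\varepsilon\in2,(\alpha,\beta)\in\mathbb{G}_0\}$. A set $E\subseteq X\times X$ ($X$ Polish) is pot$(\Pi^0_1)$ if there are finer Polish topologies $\sigma,\tau$ on $X$ making $E$ closed in $(X,\sigma)\times(X,\tau)$. $(X,A)\sqsubseteq_c(Y,B)$ means there is an injective continuous $f:X\to Y$ with $(f(x),f(y))\in B\iff(x,y)\in A$. A relation $A$ on $2^\omega$ is $\sqsubseteq_c$-minimal among non-pot$(\Pi^0_1)$ relations if it is not pot$(\Pi^0_1)$ and whenever $X$ is Polish, $S$ is a non-pot$(\Pi^0_1)$ relation on $X$ and $(X,S)\sqsubseteq_c(2^\omega,A)$, then $(2^\omega,A)\sqsubseteq_c(X,S)$. *)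

(* Defs.v *)
From HB Require Import structures.
From mathcomp Require Import all_boot all_order all_algebra.
From mathcomp Require Import all_classical all_reals topology cantor.

Set Implicit Arguments.
Unset Strict Implicit.
Unset Printing Implicit Defensive.

Local Open Scope classical_set_scope.
Local Open Scope relation_scope.

(* The topology of [X] is induced by a complete metric, and it is separable.
   The metric is a [Metric] structure on the same carrier as [X]; the library's
   [completeType] is not used because it excludes the empty space. *)
Definition polish (R : realType) (X : topologicalType) : Prop :=
  (exists d : Metric R X, let M := Metric.Pack d in
     (forall U : set X, @open M U <-> @open X U) /\
     (forall F : set_system M, ProperFilter F -> cauchy F ->
        exists x : M, F --> x)) /\
  (exists2 D : set X, countable D & dense D).

Definition finer (X : topologicalType) (sigma : Topological X) : Prop :=
  forall U : set X, @open X U -> @open (Topological.Pack sigma) U.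

Definition pot_closed (R : realType) (X : topologicalType) (E : set (X * X)) :
    Prop :=
  exists sigma tau : Topological X,
    [/\ finer sigma, finer tau,
        polish R (Topological.Pack sigma), polish R (Topological.Pack tau) &
        @closed (Topological.Pack sigma * Topological.Pack tau)%type E].

Definition reduces (X Y : topologicalType) (A : set (X * X))
    (B : set (Y * Y)) : Prop :=
  exists f : X -> Y,
    [/\ injective f, continuous f & forall x y, B (f x, f y) <-> A (x, y)].

Definition minimal_non_pot_closed (R : realType)
    (A : set (cantor_space * cantor_space)) : Prop :=
  ~ pot_closed R A /\
  forall (X : topologicalType) (S : set (X * X)),
    polish R X -> ~ pot_closed R S -> reduces S A -> reduces A S.

(* The binary words of length [k], in lexicographic order. *)
Fixpoint words (k : nat) : seq (seq bool) :=
  if k is k'.+1 then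
    [seq false :: w | w <- words k'] ++ [seq true :: w | w <- words k']
  else [:: [::]].

(* The words of length at most [n] number 2 ^ n.+1 - 1 > n, so the default
   value of [nth] is never reached. *)
Definition psi (n : nat) : seq bool :=
  nth [::] (flatten [seq words k | k <- iota 0 n.+1]) n.

Definition s_ (n : nat) : seq bool := psi n ++ nseq (n - size (psi n)) false.

(* Concatenation: for [i >= size w] the entry is the default value of [nth]. *)
Definition prepend (w : seq bool) (g : cantor_space) : cantor_space :=
  fun i : nat => nth (g (i - size w)%N) w i.

Definition G0 : set (cantor_space * cantor_space) :=
  [set p | exists (n : nat) (g : cantor_space),
     p = (prepend (rcons (s_ n) false) g, prepend (rcons (s_ n) true) g)].

Definition symmetrization (X : Type) (A : set (X * X)) : set (X * X) :=
  A `|` A^-1.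

Definition G_sG0 : set (cantor_space * cantor_space) :=
  [set p | exists a b : cantor_space,
     symmetrization G0 (a, b) /\ p = (prepend [:: false] a, prepend [:: true] b)].

Definition T0 : set (cantor_space * cantor_space) :=
  [set p | exists (e : bool) (a b : cantor_space),
     G0 (a, b) /\ p = (prepend [:: e] a, prepend [:: ~~ e] b)].

(* Main.v *)
Require Import Defs.
From HB Require Import structures.
From mathcomp Require Import all_boot all_order all_algebra.
From mathcomp Require Import all_classical all_reals topology cantor.

(** Write both relations as {(x, y) : Q x_0 y_0 and the shifts of x and y are
    s(G_0)-adjacent}.  They are not pot-closed because, by Baire category, a
    non-meager Borel set contains an s(G_0)-edge, so the pairs (0a, 1a) cannot
    be covered by countably many Borel rectangles missing the relation.

    For minimality let f : X -> 2^omega be an injective continuous map and S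
    the induced relation.  By Lusin-Souslin, images under f of basic sets of a
    finer zero-dimensional Polish topology are Borel.  If the set C of all a with
    0a and 1a in the range of f is covered by countably many Borel
    s(G_0)-independent sets, then S is closed up to removing countably many
    potentially open rectangles, hence pot-closed.  Otherwise a tree of finite
    approximations in the style of Miller's proof of the G_0-dichotomy gives
    z in 2^omega and m_0 < m_1 < ... such that g(x) := z + (x spread over the
    positions m_k) takes values in C, lifts continuously to X on both sides,
    and satisfies s_{m_k} = g(s_k 0 0 ...)|m_k.  The last condition alone makes g
    an embedding of s(G_0) into itself.  Since there are countably many
    approximations, the transfinite derivative of the usual argument is replaced
    by one removal of all approximations that can be killed by deleting countably
    many Borel independent sets. *)

Set Implicit Arguments.
Unset Strict Implicit.
Unset Printing Implicit Defensive.

Import Order.TTheory GRing.Theory Num.Theory.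

Local Open Scope classical_set_scope.

(** * Codings of Polish topologies *)

Definition agree (T : Type) (n : nat) (a b : nat -> T) :=
  forall i, (i < n)%N -> a i = b i.

Lemma agree_sym T n (a b : nat -> T) : agree n a b -> agree n b a.
Proof. by move=> h i /h ->. Qed.

Lemma agree_trans T n (b a d : nat -> T) :
  agree n a b -> agree n b d -> agree n a d.
Proof. by move=> h1 h2 i hi; rewrite h1 ?h2. Qed.

Lemma agree_le T m n (a b : nat -> T) : (m <= n)%N -> agree n a b -> agree m a b.
Proof. by move=> mn h i im; apply: h; apply: leq_trans mn. Qed.

(** Openness in the topology pulled back along [c] from the countable power of the discrete space
    [K]. For [c = id] and [K = bool] this is the topology of the Cantor space. *)
Definition copen (X K : Type) (c : X -> nat -> K) (U : set X) :=
  forall x, U x -> exists n, forall y, agree n (c y) (c x) -> U y.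

(* A coding of [X] identifies it, as a set, with a closed subset of the Baire
   space, in such a way that the induced zero-dimensional topology is finer. *)
Definition coding (X : topologicalType) (c : X -> nat -> nat) :=
  (forall b, (forall n, exists x, agree n (c x) b) -> exists x, c x = b) /\
  (forall U : set X, open U -> copen c U).

Lemma coding_inj (X : topologicalType) (c : X -> nat -> nat) :
  hausdorff_space X -> coding c -> injective c.
Proof.
move=> hX [_ cU] x y cxy; apply: hX => A B; rewrite !nbhsE.
move=> [U [oU Ux] UA] [V [oV Vy] VB]; exists y; split; last exact: VB.
apply: UA; have [n] := cU _ oU _ Ux; apply; by rewrite cxy.
Qed.

Lemma exists_least (P : nat -> Prop) :
  (exists n, P n) -> exists n, P n /\ forall m, (m < n)%N -> ~ P m.
Proof.
move=> [n Pn]; have ex : exists n, `[< P n >] by exists n; apply/asboolP.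
exists (ex_minn ex); case: ex_minnP => k /asboolP Pk kmin; split=> // m mk Pm.
by have /kmin := asboolT Pm; rewrite leqNgt mk.
Qed.

Definition least (P : nat -> Prop) : nat :=
  xget 0%N [set n | P n /\ forall m, (m < n)%N -> ~ P m].

Lemma leastP (P : nat -> Prop) : (exists n, P n) ->
  P (least P) /\ forall m, (m < least P)%N -> ~ P m.
Proof.
by move=> /exists_least[n hn]; rewrite /least; case: xgetP => // /(_ n).
Qed.

Lemma least_uniq (P : nat -> Prop) n :
  P n -> (forall m, (m < n)%N -> ~ P m) -> least P = n.
Proof.
move=> Pn nmin; have [] := @leastP P; first by exists n.
move=> Pl lmin; by have [/nmin//|/lmin//|->] := ltngtP (least P) n.
Qed.

Definition seq_cvg (X : topologicalType) (y : nat -> X) (x : X) :=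
  forall U, open U -> U x -> exists N, forall n, (N <= n)%N -> U (y n).

Lemma closed_seq_cvg (X : topologicalType) (A : set X) y x : closed A ->
  seq_cvg y x -> (exists N, forall n, (N <= n)%N -> A (y n)) -> A x.
Proof.
move=> cA yx [N hN]; apply: contrapT => nAx.
have [N' hN'] := yx (~` A) (closed_openC cA) nAx.
exact: (hN' (maxn N N') (leq_maxr _ _) (hN _ (leq_maxl _ _))).
Qed.

(* The code of a point records, for each of countably many closed covers, the
   first member containing it; not lying in that member is again witnessed by a
   cover (the cover [t e m]), which makes the set of codes closed. *)
Lemma tracked_cover_coding (X : topologicalType) (I : countType)
    (F : I -> nat -> set X) (t : I -> nat -> I) :
  (forall e x, exists m, F e m x) ->
  (forall e m, closed (F e m)) ->
  (forall e m, F (t e m) 0%N = F e m) ->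
  (forall e m k x, F (t e m) k.+1 x -> ~ F e m x) ->
  (forall y : nat -> X,
     (forall e, exists m N, forall n, (N <= n)%N -> F e m (y n)) ->
     exists x, seq_cvg y x) ->
  (forall U x, open U -> U x -> exists e, forall m, F e m x -> F e m `<=` U) ->
  exists c : X -> nat -> nat, coding c.
Proof.
move=> Fcov Fcl Ft0 FtS Fcvg Ffin.
pose c x n := if unpickle n is Some e then least (fun m => F e m x) else 0%N.
have cP x n e : unpickle n = Some e ->
    F e (c x n) x /\ forall m, (m < c x n)%N -> ~ F e m x.
  by move=> ne; rewrite /c ne; exact: leastP.
exists c; split=> [b hb|U oU x Ux].
- have [y hy] := choice hb.
  have yF n e : unpickle n = Some e -> forall k, (n < k)%N ->
      F e (b n) (y k) /\ forall m, (m < b n)%N -> ~ F e m (y k).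
    by move=> ne k nk; rewrite -(hy k n nk); exact: cP.
  have [x yx] : exists x, seq_cvg y x.
    apply: Fcvg => e; exists (b (pickle e)), (pickle e).+1 => n hn.
    by have [] := yF _ _ (pickleK e) n hn.
  exists x; apply/funext => n; case ne : (unpickle n) => [e|]; last first.
    by rewrite -(hy n.+1 n (ltnSn n)) /c ne.
  rewrite /c ne; apply: least_uniq => [|m mn Fx].
    apply: (closed_seq_cvg (@Fcl e _) yx); exists n.+1 => k nk.
    by have [] := yF _ _ ne k nk.
  (* The coordinate [n'] decides whether [x] can lie in the earlier member [F e m]. A successor
     value puts [x] in a set disjoint from [F e m]; the value 0 puts the approximants [y k] in
     [F e m], against the minimality of [b n]. *)
  pose n' := pickle (t e m).
  have hn' := pickleK (t e m).
  have hbx : F (t e m) (b n') x.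
    apply: (closed_seq_cvg (@Fcl _ _) yx); exists n'.+1 => k nk.
    by have [] := yF _ _ hn' k nk.
  case b0 : (b n') hbx => [|k] hbx; last exact: FtS hbx Fx.
  have [+ _] := yF _ _ hn' (maxn n n').+1 (leq_maxr _ _).
  rewrite b0 Ft0; have [_] := yF _ _ ne (maxn n n').+1 (leq_maxl _ _).
  by apply.
- have [e he] := Ffin _ _ oU Ux; exists (pickle e).+1 => y /(_ _ (ltnSn _)) yx.
  have [Fx _] := cP x _ _ (pickleK e); have [Fy _] := cP y _ _ (pickleK e).
  by apply: (he _ Fx); rewrite -yx.
Qed.

(** * Codings of complete separable metric spaces *)

Section polish_coding.
Local Open Scope ring_scope.
Variables (R : realType) (X : topologicalType) (d : Metric R X).
Let M : metricType R := Metric.Pack d.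
Hypothesis dX : forall U : set X, @open M U <-> @open X U.
Hypothesis dC : forall F : set_system M, ProperFilter F -> cauchy F ->
  exists x : M, F --> x.
Variable D : nat -> X.
Hypothesis Dd : dense (range D).

Let dist (x y : X) : R := @mdist R M x y.

Let dtri y x z : dist x z <= dist x y + dist y z.
Proof. exact: (@metric_triangle R M x y z). Qed.

Let dsym x y : dist x y = dist y x.
Proof. exact: (@metric_sym R M x y). Qed.

Let dxx x : dist x x = 0.
Proof. exact: (@mdistxx R M x). Qed.

Let ball_dist (x : M) r (y : M) : ball x r y = (dist x y < r).
Proof. by rewrite ballEmdist. Qed.

Let ball_open (x : X) r : @open X [set y | dist x y < r].
Proof.
apply/dX; rewrite openE => y /= xy; rewrite /interior -nbhs_ballE.
exists (r - dist x y) => /=; first by rewrite subr_gt0.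
move=> z; rewrite ball_dist => yz; apply: le_lt_trans (dtri y x z) _.
by rewrite -ltrBrDl.
Qed.

Let coball_open (x : X) r : @open X [set y | r < dist x y].
Proof.
apply/dX; rewrite openE => y /= xy; rewrite /interior -nbhs_ballE.
exists (dist x y - r) => /=; first by rewrite subr_gt0.
move=> z; rewrite ball_dist => yz.
have := dtri z x y; rewrite (dsym z y) => h.
rewrite ltrBrDl -ltrBrDr in yz; apply: lt_le_trans yz _.
by rewrite lerBlDr.
Qed.

Let openP (U : set X) x : open U -> U x ->
  exists2 r, 0 < r & forall y, dist x y < r -> U y.
Proof.
move=> /dX; rewrite openE => /(_ x) h /h; rewrite /interior -nbhs_ballE.
by move=> [r r0 rU]; exists r => // y xy; apply: rU; rewrite ball_dist.
Qed.

Let inv (k : nat) : R := k.+1%:R^-1.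

Let inv_gt0 k : 0 < inv k. Proof. by rewrite invr_gt0. Qed.

Let inv_lt r : 0 < r -> exists k, inv k < r.
Proof.
by move=> /ltr_add_invr[k]; rewrite add0r; exists k.
Qed.

Let I : countType := ((nat * bool * rat) + nat)%type.

Let invq (k : nat) : rat := k.+1%:R^-1.

Let ratr_invq k : ratr (invq k) = inv k :> R.
Proof. by rewrite fmorphV rmorph_nat. Qed.

(** The index [inl (j, true, q)] starts with a closed ball about [D j] and exhausts its complement
    by closed sets; [inl (j, false, q)] starts with the complement of an open ball and exhausts that
    ball. The covers [inr k] by balls of radius [inv k] yield Cauchy sequences and small
    neighbourhoods. Each member is the zeroth set of another cover, which [t] names. *)
Let F (e : I) (m : nat) : set X :=
  match e with
  | inl (j, true, q) =>
      if m is k.+1 then [set x | ratr (q + invq k) <= dist (D j) x]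
      else [set x | dist (D j) x <= ratr q]
  | inl (j, false, q) =>
      if m is k.+1 then [set x | dist (D j) x <= ratr (q - invq k)]
      else [set x | ratr q <= dist (D j) x]
  | inr k => [set x | dist (D m) x <= ratr (invq k)]
  end.

Let t (e : I) (m : nat) : I :=
  match e with
  | inl (j, true, q) =>
      if m is k.+1 then inl (j, false, q + invq k) else inl (j, true, q)
  | inl (j, false, q) =>
      if m is k.+1 then inl (j, true, q - invq k) else inl (j, false, q)
  | inr k => inl (m, true, invq k)
  end.

Lemma complete_separable_coding : exists c : X -> nat -> nat, coding c.
Proof.
apply: (@tracked_cover_coding X I F t).
- move=> [[[j []] q]|k] x.
  + have [h|h] := leP (dist (D j) x) (ratr q); first by exists 0%N.
    move: h; rewrite -subr_gt0 => /inv_lt[k hk]; exists k.+1 => /=.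
    by rewrite rmorphD /= ratr_invq -lerBrDl ltW.
  + have [h|h] := leP (ratr q) (dist (D j) x); first by exists 0%N.
    move: h; rewrite -subr_gt0 => /inv_lt[k hk]; exists k.+1 => /=.
    by rewrite rmorphB /= ratr_invq lerBrDl -lerBrDr ltW.
  + have := Dd _ (ball_open x (inv k)).
    case; first by exists x => /=; rewrite dxx.
    move=> y [/= xy [m _ my]]; exists m => /=.
    by rewrite ratr_invq my dsym ltW.
- move=> e m.
  have c1 j r : closed [set x | dist (D j) x <= r].
    rewrite -[X in closed X]setCK; apply: open_closedC.
    have -> : ~` [set x | dist (D j) x <= r] = [set x | r < dist (D j) x].
      by apply/seteqP; split=> x /=; rewrite ltNge => /negP.
    exact: coball_open.
  have c2 j r : closed [set x | r <= dist (D j) x].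
    rewrite -[X in closed X]setCK; apply: open_closedC.
    have -> : ~` [set x | r <= dist (D j) x] = [set x | dist (D j) x < r].
      by apply/seteqP; split=> x /=; rewrite ltNge => /negP.
    exact: ball_open.
  by case: e => [[[j []] q]|k] /=; case: m.
- by move=> [[[j []] q]|k] [|m].
- move=> e m k x.
  suff h q i : ratr q < ratr (q + invq i) :> R /\ ratr (q - invq i) < ratr q :> R.
    case: e => [[[j []] q]|l] /=; case: m => [|m] /= Fx; apply/negP; rewrite -ltNge.
    + exact: lt_le_trans (h _ _).1 Fx.
    + exact: le_lt_trans Fx (h _ _).2.
    + exact: le_lt_trans Fx (h _ _).2.
    + exact: lt_le_trans (h _ _).1 Fx.
    + exact: lt_le_trans (h _ _).1 Fx.
    + exact: lt_le_trans (h _ _).1 Fx.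
  by rewrite rmorphB rmorphD /= ratr_invq ltrDl ltrBlDr ltrDl inv_gt0.
- move=> y hy.
  have [|x yx] := @dC (y @ \oo) _.
    apply/cauchy_ballP => r r0.
    have /inv_lt[k hk] : 0 < r / 2 by rewrite divr_gt0.
    have [m [N hN]] := hy (inr k).
    have hB : (y @ \oo) [set z | dist (D m) z <= inv k].
      by exists N => // n /hN /=; rewrite ratr_invq.
    exists ([set z | dist (D m) z <= inv k], [set z | dist (D m) z <= inv k]) => //.
    move=> [u v] [/= hu hv]; rewrite ball_dist.
    apply: le_lt_trans (dtri (D m) u v) _.
    rewrite (splitr r) dsym; apply: ltrD.
      exact: le_lt_trans hu hk.
    exact: le_lt_trans hv hk.
  exists x => U oU Ux; have [|N _ hN] := yx U; last by exists N.
  by apply: open_nbhs_nbhs; split=> //; apply/dX.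
- move=> U x oU Ux; have [r r0 rU] := openP oU Ux.
  have /inv_lt[k hk] : 0 < r / 2 by rewrite divr_gt0.
  exists (inr k) => m /= xm y /= ym; rewrite !ratr_invq in xm ym.
  apply: rU; apply: le_lt_trans (dtri (D m) x y) _.
  rewrite (splitr r) dsym; apply: ltrD.
    exact: le_lt_trans xm hk.
  exact: le_lt_trans ym hk.
Qed.

End polish_coding.

Lemma polish_coding (R : realType) (X : topologicalType) : polish R X ->
  exists c : X -> nat -> nat, coding c.
Proof.
move=> [[d [dX dC]] [D cD dD]].
(* An empty dense set forces [X] to be empty, and then any function is a coding. *)
have [D0|/set0P[x0 Dx0]] := eqVneq D set0.
  exists (fun _ _ => 0%N); split=> [b /(_ 0%N)[x _]|U _ x _]; exfalso.
    by have [|y] := dD setT _ openT; [exists x|rewrite D0 => -[]].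
  by have [|y] := dD setT _ openT; [exists x|rewrite D0 => -[]].
have /pfcard_geP[D0|[e]] := cD; first by rewrite D0 in Dx0.
apply: (complete_separable_coding dX dC (D := e)).
by have -> : range e = D by exact: image_eq.
Qed.

Lemma polish_hausdorff (R : realType) (X : topologicalType) :
  polish R X -> hausdorff_space X.
Proof.
move=> [[d [dX _]] _] x y xy.
apply: (@metric_hausdorff R (Metric.Pack d) x y) => A B.
rewrite !nbhsE => -[U [/dX oU Ux] UA] [V [/dX oV Vx] VB].
have [z [Uz Vz]] : U `&` V !=set0.
  by apply: xy; apply: open_nbhs_nbhs; split.
by exists z; split; [exact: UA|exact: VB].
Qed.

(** * Polish topologies obtained from codings *)

Lemma eq_codeP (X K : Type) (c : X -> nat -> K) n x y :
  [seq c x i | i <- iota 0 n] = [seq c y i | i <- iota 0 n] <->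
  agree n (c x) (c y).
Proof.
split=> [h i ni|h]; last first.
  by apply/eq_in_map => i; rewrite mem_iota => /andP[_]; exact: h.
have := congr1 (fun s => nth (c x i) s i) h.
by rewrite !(nth_map 0%N) ?size_iota // nth_iota.
Qed.

(** A copy of the carrier that remembers [c] and its injectivity, so that the metric of the codes
    can be attached to it as a structure. *)
Definition coded (R : realType) (X : choiceType) (c : X -> nat -> nat)
  of injective c : Type := X.

Section coded_metric.
Local Open Scope ring_scope.
Variables (R : realType) (X : choiceType) (c : X -> nat -> nat).
Hypothesis cI : injective c.

Local Notation T := (coded R cI).

HB.instance Definition _ := Choice.on T.

Let inv (k : nat) : R := k.+1%:R^-1.

Let inv_gt0 k : 0 < inv k. Proof. by rewrite invr_gt0. Qed.

Let ltr_inv k n : (inv k < inv n) = (n < k)%N.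
Proof. by rewrite ltf_pV2 ?posrE // ltr_nat. Qed.

Definition code_dist (x y : T) : R :=
  if `[< x = y >] then 0 else inv (least (fun n => c x n <> c y n)).

Let dist_lt x y n : code_dist x y < inv n <-> agree n.+1 (c x) (c y).
Proof.
rewrite /code_dist; case: asboolP => [->|xy]; first by rewrite inv_gt0.
have [|dl dmin] := @leastP (fun n => c x n <> c y n).
  apply: contrapT => /forallNP h; apply: xy; apply: cI; apply/funext => m.
  exact: contrapT (h m).
rewrite ltr_inv; split=> [nk i ni|h].
  by apply: contrapT; apply: dmin; apply: leq_trans nk.
by rewrite ltnNge; apply/negP => /h.
Qed.

Let dist_ge0 x y : 0 <= code_dist x y.
Proof. by rewrite /code_dist; case: asboolP => // _; exact: ltW. Qed.

Let distxx x : code_dist x x = 0.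
Proof. by rewrite /code_dist asboolT. Qed.

Let dist_pos x y : code_dist x y = 0 -> x = y.
Proof.
rewrite /code_dist; case: asboolP => // _ /eqP.
by rewrite gt_eqF.
Qed.

Let dist_sym x y : code_dist x y = code_dist y x.
Proof.
rewrite /code_dist; have -> : (x = y) = (y = x) by apply/propext; split=> ->.
case: asboolP => // _; congr (inv (least _)).
by apply/funext => n; apply/propext; split=> h /esym.
Qed.

Let dist_tri y x z : code_dist x z <= code_dist x y + code_dist y z.
Proof.
rewrite {1}/code_dist; case: asboolP => [_|xz]; first exact: addr_ge0.
set k := least _.
have [h1|h1] := ltP (code_dist x y) (inv k); last first.
  by apply: le_trans h1 _; rewrite lerDl.
have [h2|h2] := ltP (code_dist y z) (inv k); last first.
  by apply: le_trans h2 _; rewrite lerDr.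
have : code_dist x z < inv k.
  by apply/dist_lt; apply: agree_trans; apply/dist_lt; eassumption.
by rewrite /code_dist asboolF // ltxx.
Qed.

HB.instance Definition _ :=
  isMetric.Build R T distxx dist_pos dist_sym dist_tri.

Lemma coded_open (U : set X) : @open T U <-> copen c U.
Proof.
rewrite openE; split=> [oU x Ux|cU x Ux].
  have := oU _ Ux; rewrite /interior -nbhs_ballE => -[r /= r0 rU].
  have [k] := ltr_add_invr r0; rewrite add0r => kr.
  exists k.+1 => y /agree_sym/dist_lt yx; apply: rU.
  by rewrite ballEmdist /=; exact: lt_trans yx kr.
have [n hn] := cU _ Ux; rewrite /interior -nbhs_ballE.
exists (inv n) => //= y; rewrite ballEmdist => /dist_lt xy.
by apply: hn; apply: agree_le (agree_sym xy).
Qed.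

Hypothesis cC : forall b, (forall n, exists x, agree n (c x) b) ->
  exists x, c x = b.

(** Completeness: along a Cauchy filter each coordinate of the code stabilizes, and closedness of
    the set of codes supplies a point with the limit code. Separability: choose one point for each
    finite code prefix that occurs. *)
Lemma coded_polish : polish R T.
Proof.
split.
- exists (Metric.class T); split=> // F FF /cauchy_ballP Fc.
  have /choice[x hx] n : exists x : T, F [set y | agree n (c x) (c y)].
    have [[A B] /= [FA FB] AB] := Fc (inv n) (inv_gt0 n).
    have [x [Ax Bx]] := filter_ex (filterI FA FB).
    exists x; apply: filterS FB => y By /=.
    have := AB (x, y) (conj Ax By); rewrite ballEmdist => /dist_lt.
    exact: agree_le.
  pose b n := c (x n.+1) n.
  have xb n : agree n (c (x n)) b.
    move=> i ni; have [y [h1 h2]] := filter_ex (filterI (hx n) (hx i.+1)).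
    by rewrite h1 // /b h2.
  have [|z zb] := cC (b := b); first by move=> n; exists (x n).
  exists z => A; rewrite -nbhs_ballE => -[r /= r0 rA].
  have [k] := ltr_add_invr r0; rewrite add0r => kr.
  apply: filterS (hx k.+1) => y /= xy; apply: rA; rewrite ballEmdist /=.
  apply: lt_trans kr; apply/dist_lt; rewrite zb.
  by apply: agree_trans xy; exact/agree_sym/xb.
- have [[x0 _]|X0] := pselect (exists x : T, True); last first.
    exists set0; first exact: countable0.
    by move=> U [x _]; exfalso; apply: X0; exists x.
  pose g (s : seq nat) : T :=
    xget x0 [set x | [seq c x i | i <- iota 0 (size s)] = s].
  exists (range g); first by apply: card_le_trans (card_image_le _ _) _; exact: countableP.
  move=> U [x Ux] /coded_open/(_ _ Ux)[n hn].
  pose s := [seq c x i | i <- iota 0 n].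
  exists (g s); split; last by exists s.
  have ss : size s = n by rewrite size_map size_iota.
  have gs : [seq c (g s) i | i <- iota 0 (size s)] = s.
    by rewrite /g; case: xgetP => [z _ //|/(_ x)]; case; rewrite /= ss.
  by apply: hn; apply/eq_codeP; move: gs; rewrite ss.
Qed.

End coded_metric.

Lemma coding_polish (R : realType) (X : topologicalType) c :
  hausdorff_space X -> @coding X c ->
  exists sigma : Topological X, [/\ finer sigma, polish R (Topological.Pack sigma)
    & forall U : set X, @open (Topological.Pack sigma) U <-> copen c U].
Proof.
move=> hX cc; have cI := coding_inj hX cc; have [cC cU] := cc.
exists (Topological.class (coded R cI)); split=> [U oU||U].
- exact/coded_open/cU.
- exact: coded_polish.
- exact: coded_open.
Qed.

Lemma coding_pot_closed (R : realType) (X : topologicalType) c (E : set (X * X)) :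
  hausdorff_space X -> @coding X c ->
  (forall x y, ~ E (x, y) -> exists n, forall x' y',
     agree n (c x') (c x) -> agree n (c y') (c y) -> ~ E (x', y')) ->
  pot_closed R E.
Proof.
move=> hX cc hE; have [sigma [fs ps oP]] := coding_polish R hX cc.
exists sigma, sigma; split=> //; rewrite -[E]setCK; apply: open_closedC.
rewrite openE => -[x y] /hE[n hn].
have on z : @open (Topological.Pack sigma) [set z' | agree n (c z') (c z)].
  by apply/oP => z' /= z'z; exists n => y'; move/agree_trans; exact.
exists ([set z | agree n (c z) (c x)], [set z | agree n (c z) (c y)]).
  by split; apply: open_nbhs_nbhs; split=> //; exact: on.
by move=> [x' y'] [/= hx hy]; exact: hn.
Qed.

(** A point outside [E] has an open box missing [E]. Codings of the two finer topologies shrink its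
    sides to cylinders, and [maxn] gives them a common length. *)
Lemma pot_closed_coding (R : realType) (X : topologicalType) (E : set (X * X)) :
  pot_closed R E -> exists c c' : X -> nat -> nat,
  [/\ coding c, coding c' &
   forall x y, ~ E (x, y) -> exists n, forall x' y',
     agree n (c x') (c x) -> agree n (c' y') (c' y) -> ~ E (x', y')].
Proof.
move=> [sigma [tau [fs ft /polish_coding[c [cC cU]] /polish_coding[c' [cC' cU']] cE]]].
exists c, c'; split=> [||x y nE].
- by split=> // U /fs/cU.
- by split=> // U /ft/cU'.
have : nbhs (((x : Topological.Pack sigma), (y : Topological.Pack tau)) :
    (Topological.Pack sigma * Topological.Pack tau)%type) (~` E).
  by move: (closed_openC cE); rewrite openE => /(_ (x, y)); exact.
move=> [[A B] [hA hB] AB].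
have : nbhs (x : Topological.Pack sigma) A by exact: hA.
rewrite nbhsE => -[U [oU Ux] UA].
have : nbhs (y : Topological.Pack tau) B by exact: hB.
rewrite nbhsE => -[V [oV Vy] VB].
have [m hm] := cU _ oU _ Ux; have [n hn] := cU' _ oV _ Vy.
exists (maxn m n) => x' y' hx hy; apply: (AB (x', y')); split=> /=.
  by apply: UA; apply: hm; apply: agree_le hx; exact: leq_maxl.
by apply: VB; apply: hn; apply: agree_le hy; exact: leq_maxr.
Qed.

(** * Borel subsets of the Cantor space and the Lusin-Souslin theorem *)

(** If no cylinder about [x] fits in [U], points outside [U] taken from shrinking cylinders converge
    to [x]. Conversely, a cylinder is a finite intersection of coordinate preimages. *)
Lemma cantor_openP (U : set cantor_space) : open U <-> copen id U.
Proof.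
split=> [oU x Ux|cU].
- apply: contrapT => /forallNP h.
  have /choice[y hy] n : exists y : cantor_space, agree n y x /\ ~ U y.
    by have /existsNP[y /not_implyP[h1 h2]] := h n; exists y.
  have : (y : nat -> cantor_space) @ \oo --> (x : cantor_space).
    apply/cvg_sup => i; apply/cvg_image.
      by apply/seteqP; split=> // b _; exists (fun=> b).
    move=> A /= Ax; exists [set z : cantor_space | A (z i)].
      exists i.+1 => // n /= ni; have [/(_ i ni) e _] := hy n.
      by rewrite e; exact: (nbhs_singleton Ax).
    apply/seteqP; split=> [_ [z Az <-] //|b Ab].
    by exists (fun=> b).
  move=> /(_ U (open_nbhs_nbhs (conj oU Ux)))[N _ /(_ N (leqnn N))].
  by have [_] := hy N.
- rewrite openE => x /cU[n hn].
  have hy : forall i, nbhs (x : cantor_space) [set y : cantor_space | y i = x i].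
    move=> i; apply: (@proj_continuous nat (fun _ => bool) i x [set b | b = x i]).
    by apply: open_nbhs_nbhs; split=> //; exact: discrete_open.
  have : forall k, nbhs (x : cantor_space) [set y : cantor_space | agree k y x].
    elim=> [|k IH]; first by apply: filterS (hy 0%N) => y _ i.
    apply: filterS (filterI IH (hy k)) => y [h1 h2] i.
    by rewrite ltnS leq_eqVlt => /orP[/eqP->|/h1].
  by move=> /(_ n); apply: filterS => y /hn.
Qed.

Definition ccont (Z K L : Type) (c : Z -> nat -> K) (p : Z -> nat -> L) :=
  forall z n, exists m, forall z', agree m (c z') (c z) -> agree n (p z') (p z).

Lemma copen_preimage (Z K L : Type) (c : Z -> nat -> K) (p : Z -> nat -> L)
    (U : set (nat -> L)) :
  ccont c p -> copen id U -> copen c (p @^-1` U).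
Proof.
move=> cp oU z /= /oU[n hn]; have [m hm] := cp z n.
by exists m => z' /hm /hn.
Qed.

Definition cclosed (Z K : Type) (c : Z -> nat -> K) :=
  forall b, (forall n, exists z, agree n (c z) b) -> exists z, c z = b.

Inductive borel : set (nat -> bool) -> Prop :=
| borel_open U : copen id U -> borel U
| borelC A : borel A -> borel (~` A)
| borel_bigcup (A : nat -> set (nat -> bool)) :
    (forall i, borel (A i)) -> borel (\bigcup_i A i).

Lemma borel0 : borel set0.
Proof. by apply: borel_open => x []. Qed.

Lemma borelT : borel setT.
Proof. by rewrite -setC0; exact: borelC borel0. Qed.

Lemma borel_countable_bigcup (I : countType) (A : I -> set (nat -> bool)) :
  (forall i, borel (A i)) -> borel (\bigcup_i A i).
Proof.
move=> bA; pose A' n := if unpickle n is Some i then A i else set0.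
have -> : \bigcup_i A i = \bigcup_n A' n.
  apply/seteqP; split=> x [i _].
    by exists (pickle i) => //; rewrite /A' pickleK.
  by rewrite /A'; case: unpickle => [j|//]; exists j.
apply: borel_bigcup => n; rewrite /A'.
by case: unpickle => [j|]; [exact: bA|exact: borel0].
Qed.

Lemma borel_bigcap (I : countType) (A : I -> set (nat -> bool)) :
  (forall i, borel (A i)) -> borel (\bigcap_i A i).
Proof.
move=> bA; rewrite -[X in borel X]setCK setC_bigcap.
by apply: borelC; apply: borel_countable_bigcup => i; exact: borelC.
Qed.

Lemma borelI A B : borel A -> borel B -> borel (A `&` B).
Proof.
move=> bA bB.
have -> : A `&` B = \bigcap_(b : bool) (if b then A else B).
  apply/seteqP; split=> [x [Ax Bx] [] //|x h].
  by split; [exact: (h true)|exact: (h false)].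
by apply: borel_bigcap => -[].
Qed.

Lemma borelD A B : borel A -> borel B -> borel (A `\` B).
Proof. by move=> bA bB; rewrite setDE; apply: borelI => //; exact: borelC. Qed.

Lemma borel_preimage (p : (nat -> bool) -> nat -> bool) B :
  ccont id p -> borel B -> borel (p @^-1` B).
Proof.
move=> cp; elim=> [U oU|A _|A _ IH].
- by apply: borel_open; exact: copen_preimage.
- by rewrite preimage_setC; exact: borelC.
- by rewrite preimage_bigcup; exact: borel_bigcup.
Qed.

Definition separated (A B : set (nat -> bool)) :=
  exists C, [/\ borel C, A `<=` C & C `&` B = set0].

Lemma separated_bigcup (A B : nat -> set (nat -> bool)) :
  (forall i j, separated (A i) (B j)) ->
  separated (\bigcup_i A i) (\bigcup_j B j).
Proof.
move=> h; have /choice[C hC] ij : exists C, [/\ borel C, A ij.1 `<=` C & C `&` B ij.2 = set0].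
  exact: h.
exists (\bigcup_i \bigcap_j C (i, j)); split.
- apply: borel_bigcup => i; apply: borel_bigcap => j.
  by have [] := hC (i, j).
- move=> x [i _ Ax]; exists i => // j _; have [_ + _] := hC (i, j); exact.
- apply/seteqP; split=> // x [[i _ Cx] [j _ Bx]].
  by have [_ _ <-] := hC (i, j); split=> //; exact: Cx.
Qed.

Definition upd (T : Type) (a : nat -> T) n k := fun i => if i == n then k else a i.

Lemma agree_upd T n (a : nat -> T) k : agree n (upd a n k) a.
Proof. by move=> i /ltn_eqF; rewrite /upd => ->. Qed.

Definition cyl (Z : Type) (c : Z -> nat -> nat) n (a : nat -> nat) : set Z :=
  [set z | agree n (c z) a].

Lemma cyl_split (Z : Type) (c : Z -> nat -> nat) n a :
  cyl c n a = \bigcup_k cyl c n.+1 (upd a n k).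
Proof.
apply/seteqP; split=> z.
  move=> h; exists (c z n) => // i; rewrite ltnS leq_eqVlt /upd => /orP[/eqP->|i_n].
    by rewrite eqxx.
  by rewrite ltn_eqF //; exact: h.
by move=> [k _ h]; apply: agree_trans (agree_upd _ _); apply: agree_le h.
Qed.

(** Inseparability of two images passes, by [separated_bigcup], to a pair of cylinders one step
    longer, hence down to two limit points. Their images differ in some coordinate, and fixing that
    coordinate separates the images of small enough cylinders. *)
Lemma lusin_separation (Z W : Type) (c : Z -> nat -> nat) (d : W -> nat -> nat)
    (p : Z -> nat -> bool) (q : W -> nat -> bool) n0 a0 b0 :
  cclosed c -> cclosed d -> ccont c p -> ccont d q ->
  p @` cyl c n0 a0 `&` q @` cyl d n0 b0 = set0 ->
  separated (p @` cyl c n0 a0) (q @` cyl d n0 b0).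
Proof.
move=> cc cd cp cq pq0; apply: contrapT => nsep.
pose bad n (ab : (nat -> nat) * (nat -> nat)) :=
  ~ separated (p @` cyl c n ab.1) (q @` cyl d n ab.2).
have /choice[step hstep] : forall s : nat * ((nat -> nat) * (nat -> nat)),
    exists kl : nat * nat, bad s.1 s.2 ->
      bad s.1.+1 (upd s.2.1 s.1 kl.1, upd s.2.2 s.1 kl.2).
  move=> [n [a b]]; have [hb|] := pselect (bad n (a, b)); last by exists (0, 0)%N.
  apply: contrapT => /forallNP h; apply: hb => /=.
  rewrite (cyl_split c) (cyl_split d) !image_bigcup; apply: separated_bigcup => i j.
  by have /not_implyP[_ /contrapT] := h (i, j).
pose fix st k := if k is k'.+1 then
    let s := st k' in let kl := step ((n0 + k')%N, s) in
    (upd s.1 (n0 + k') kl.1, upd s.2 (n0 + k') kl.2)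
  else (a0, b0).
have st_bad k : bad (n0 + k)%N (st k).
  elim: k => [|k IH]; first by rewrite addn0.
  by rewrite addnS; apply: (hstep ((n0 + k)%N, st k)).
have st_agree k l : (k <= l)%N ->
    agree (n0 + k) (st l).1 (st k).1 /\ agree (n0 + k) (st l).2 (st k).2.
  elim: l => [|l IH]; first by rewrite leqn0 => /eqP->.
  rewrite leq_eqVlt ltnS => /orP[/eqP->//|kl]; have [h1 h2] := IH kl.
  split; [apply: agree_trans h1|apply: agree_trans h2];
    by apply: agree_le (agree_upd _ _); rewrite leq_add2l.
pose a i := (st i.+1).1 i; pose b i := (st i.+1).2 i.
have aP k : agree (n0 + k) (st k).1 a /\ agree (n0 + k) (st k).2 b.
  split=> i ik.
    have [/(_ i) h _] := st_agree _ _ (leq_maxl k i.+1).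
    have [/(_ i) h' _] := st_agree _ _ (leq_maxr k i.+1).
    by rewrite -h // h' // addnS ltnS leq_addl.
  have [_ /(_ i) h] := st_agree _ _ (leq_maxl k i.+1).
  have [_ /(_ i) h'] := st_agree _ _ (leq_maxr k i.+1).
  by rewrite -h // h' // addnS ltnS leq_addl.
have badab k : ~ separated (p @` cyl c (n0 + k) a) (q @` cyl d (n0 + k) b).
  have cylE (Y : Type) (e : Y -> nat -> nat) n u v : agree n u v -> cyl e n u = cyl e n v.
    move=> uv; apply/seteqP; split=> y h; apply: agree_trans h _ => //.
    exact: agree_sym.
  have [h1 h2] := aP k.
  by have := st_bad k; rewrite /bad (cylE _ _ _ _ _ h1) (cylE _ _ _ _ _ h2).
(* An empty cylinder about [a] would have an empty image, which [set0] separates; so closedness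
   yields a point with code [a]. *)
have [z za] : exists z, c z = a.
  apply: cc => n; apply: contrapT => nz; apply: (badab n).
  exists set0; split; [exact: borel0| |by rewrite set0I].
  move=> _ [z hz <-]; apply: nz; exists z; apply: agree_le hz; exact: leq_addl.
have [w wb] : exists w, d w = b.
  apply: cd => n; apply: contrapT => nz; apply: (badab n).
  exists (~` set0); split; [exact: borelC borel0|by rewrite setC0|].
  rewrite setC0 setTI; apply/seteqP; split=> // _ [y hy <-].
  apply: nz; exists y; apply: agree_le hy; exact: leq_addl.
have [i hi] : exists i, p z i <> q w i.
  apply: contrapT => /forallNP h.
  suff : (p @` cyl c n0 a0 `&` q @` cyl d n0 b0) (p z) by rewrite pq0.
  have [h1 h2] := aP 0%N; rewrite addn0 in h1 h2.
  split; first by exists z => //; rewrite /cyl /= za; exact: agree_sym.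
  exists w; first by rewrite /cyl /= wb; exact: agree_sym.
  by apply/funext => i; have /contrapT := h i.
have [m hm] := cp z i.+1; have [m' hm'] := cq w i.+1.
apply: (badab (maxn m m')); exists [set x | x i = p z i]; split.
- apply: borel_open => x /= xi; exists i.+1 => y /(_ i (ltnSn i)) ->.
  by [].
- move=> _ [y hy <-] /=; apply: (hm y) => //; rewrite za; apply: agree_le hy.
  by apply: leq_trans (leq_maxl m m') (leq_addl _ _).
- apply/seteqP; split=> // v [/= h [y hy e]]; apply: hi; rewrite -h -e.
  apply: (hm' y) => //; rewrite wb; apply: agree_le hy.
  by apply: leq_trans (leq_maxr m m') (leq_addl _ _).
Qed.

Lemma mkseq_agree (T : Type) (a b : nat -> T) n : mkseq a n = mkseq b n <-> agree n a b.
Proof. exact: (eq_codeP (fun u : nat -> T => u)). Qed.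

(** By injectivity, distinct cylinders of equal length have disjoint images, so these images have
    pairwise disjoint Borel hulls. A point is in the range exactly when, at every length, some word
    and all its prefixes have hulls containing it. *)
Lemma lusin_souslin (Z : Type) (c : Z -> nat -> nat) (p : Z -> nat -> bool) :
  cclosed c -> ccont c p -> injective p ->
  forall n a, borel (p @` cyl c n a).
Proof.
move=> cc cp pI.
pose N (t : seq nat) := cyl c (size t) (nth 0%N t).
have NP t z : N t z <-> mkseq (c z) (size t) = t.
  split=> [/mkseq_agree|h]; first by rewrite mkseq_nth.
  by apply/mkseq_agree; rewrite mkseq_nth.
have /choice[C hC] : forall st : seq nat * seq nat, exists C,
    size st.1 = size st.2 -> st.1 <> st.2 ->
    [/\ borel C, p @` N st.1 `<=` C & C `&` p @` N st.2 = set0].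
  move=> [s t] /=.
  have [ste|] := pselect (size s = size t); last by exists set0.
  have [|st] := pselect (s = t); first by exists set0.
  have [] := @lusin_separation _ _ c c p p (size s) (nth 0%N s) (nth 0%N t) cc cc cp cp.
    apply/seteqP; split=> // _ [[z Nz <-] [w Nw /pI wz]]; apply: st; subst w.
    by rewrite ste in Nw *; have /NP <- := Nz; have /NP <- := Nw; rewrite ste.
  by move=> D; rewrite {2}ste; exists D.
(* [K t] is the closure of the image of the cylinder [N t]. *)
pose K t := [set x | forall n, exists2 z, N t z & agree n (p z) x].
have bK t : borel (K t).
  rewrite -[K t]setCK; apply: borelC; apply: borel_open => x /existsNP[n hn].
  exists n => y yx hy; apply: hn; have [z Nz zy] := hy n.
  by exists z => //; exact: agree_trans yx.
(* The closure is trimmed by the separators: for another word [s] of the same length, [B t] avoids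
   [C (s, t)] while [B s] lies in it. *)
pose B t := K t `&` \bigcap_(s : seq nat)
  [set x | size s = size t -> s <> t -> (C (t, s) `\` C (s, t)) x].
have bB t : borel (B t).
  apply: borelI => //; apply: borel_bigcap => s.
  have [ste|ste] := pselect (size s = size t); last first.
    rewrite [X in borel X](_ : _ = setT); first exact: borelT.
    by apply/seteqP; split.
  have [st|st] := pselect (s = t).
    rewrite [X in borel X](_ : _ = setT); first exact: borelT.
    by apply/seteqP; split.
  rewrite [X in borel X](_ : _ = C (t, s) `\` C (s, t)); last first.
    by apply/seteqP; split=> x /=; [apply|].
  by apply: borelD; [have [] := hC (t, s)|have [] := hC (s, t)] => //= /esym.
have NB t z : N t z -> B t (p z).
  move=> Nz; split=> [n|s _ /= ste st]; first by exists z.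
  split.
    have [_ + _] := hC (t, s) (esym ste) (fun h => st (esym h)).
    by apply; exists z.
  have [_ _ h] := hC (s, t) ste st => Cz.
  have : (C (s, t) `&` p @` N t) (p z) by split=> //; exists z.
  by rewrite h.
have Bdisj s t x : size s = size t -> B s x -> B t x -> s = t.
  move=> ste [_ Bs] [_ Bt]; apply: contrapT => st.
  have [_] := Bs t I (esym ste) (fun h => st (esym h)).
  by have [+ _] := Bt s I ste st.
pose B' (t : seq nat) := \bigcap_(k : nat) B (take k t).
have bB' t : borel (B' t) by apply: borel_bigcap => k; exact: bB.
have prange x : (p @` setT) x <->
    forall n, exists t, size t = n /\ B' t x.
  split=> [[z _ <-] n|/choice[t ht]].
    exists (mkseq (c z) n); split; first by rewrite size_mkseq.
    move=> k _; apply: NB; apply/NP.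
    have [kn|nk] := leqP k n.
      by rewrite /mkseq -map_take take_iota (minn_idPl kn) size_map size_iota.
    by rewrite take_oversize ?size_mkseq // ltnW.
  (* Disjointness of the hulls makes the words [t n] initial segments of one sequence [b]. The point
     with code [b] is mapped to [x], since [x] lies in the closures [K] along [b]. *)
  pose b i := nth 0%N (t i.+1) i.
  have tb n : t n = mkseq b n.
    have tk k : (k <= n)%N -> take k (t n) = t k.
      move=> kn; have [tn h] := ht n; have [tk h'] := ht k.
      apply: (@Bdisj _ _ x).
      - by rewrite size_take_min tn tk; apply/minn_idPl.
      - exact: h.
      - by have := h' k I; rewrite take_oversize // tk.
    have [tn _] := ht n; apply: (@eq_from_nth _ 0%N) => [|i].
      by rewrite size_mkseq.
    by rewrite tn => ni; rewrite nth_mkseq // /b -(tk i.+1) // nth_take.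
  have KB n : K (mkseq b n) x.
    have [tn h] := ht n; have := h n I; rewrite take_oversize ?tn // tb.
    by case.
  have [z zb] : exists z, c z = b.
    apply: cc => n; have [z + _] := KB n 0%N; move=> /NP.
    by rewrite size_mkseq => /mkseq_agree; exists z.
  exists z => //; apply/funext => i.
  have [m hm] := cp z i.+1; have [z' /NP + h] := KB m i.+1.
  rewrite size_mkseq -zb => /mkseq_agree/hm/(_ i (ltnSn i)) <-.
  exact: h.
have bpT : borel (p @` setT).
  have -> : p @` setT = \bigcap_(n : nat) \bigcup_(t : seq nat)
      (if size t == n then B' t else set0).
    apply/seteqP; split=> x.
      move=> /prange h n _; have [t [/eqP tn Bt]] := h n.
      by exists t => //; rewrite tn.
    move=> h; apply/prange => n; have [t _] := h n I.
    by case: eqP => // tn Bt; exists t.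
  apply: borel_bigcap => n; apply: borel_countable_bigcup => t.
  by case: eqP => // _; exact: borel0.
move=> n a; pose t := mkseq a n.
have -> : p @` cyl c n a = p @` setT `&` B t.
  have Nt : cyl c n a = N t.
    apply/seteqP; split=> z.
      by move=> /mkseq_agree h; apply/NP; rewrite size_mkseq.
    by move=> /NP; rewrite size_mkseq => /mkseq_agree.
  rewrite Nt; apply/seteqP; split=> [_ [z Nz <-]|_ [[z _ <-] Bz]].
    by split; [exists z|exact: NB].
  exists z => //; have : B (mkseq (c z) (size t)) (p z).
    by apply: NB; apply/NP; rewrite size_mkseq.
  move=> /(Bdisj _ _ _) h; apply/NP; apply: h => //; by rewrite size_mkseq.
exact: borelI.
Qed.

(** * Making Borel preimages clopen *)

Definition clop (X : Type) (c : X -> nat -> nat) (A : set X) :=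
  forall x, exists n, forall y, agree n (c y) (c x) -> (A y <-> A x).

Lemma ccont_copen (X : Type) (c d : X -> nat -> nat) (U : set X) :
  ccont d c -> copen c U -> copen d U.
Proof.
move=> dc cU x /cU[n hn]; have [m hm] := dc x n.
by exists m => y /hm/hn.
Qed.

Lemma ccont_clop (X : Type) (c d : X -> nat -> nat) (A : set X) :
  ccont d c -> clop c A -> clop d A.
Proof.
move=> dc cA x; have [n hn] := cA x; have [m hm] := dc x n.
by exists m => y /hm/hn.
Qed.

Lemma clop_copen (X : Type) (c : X -> nat -> nat) (A : set X) :
  clop c A -> copen c A.
Proof. by move=> cA x Ax; have [n hn] := cA x; exists n => y /hn ->. Qed.

(** The codes are interleaved through a pairing. Limits found in the separate codings coincide
    because all of them refine one Hausdorff topology. *)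
Lemma coding_join (X : topologicalType) (c : nat -> X -> nat -> nat) :
  hausdorff_space X -> (forall i, coding (c i)) ->
  exists d, coding d /\ forall i, ccont d (c i).
Proof.
move=> hX cc.
pose d x k := if (unpickle k : option (nat * nat)) is Some ij then c ij.1 x ij.2
              else 0%N.
have dc i n : exists m, forall x b, agree m (d x) b ->
    forall j, (j < n)%N -> c i x j = b (pickle (i, j)).
  elim: n => [|n [m hm]]; first by exists 0%N.
  exists (maxn m (pickle (i, n)).+1) => x b h j.
  rewrite ltnS leq_eqVlt => /orP[/eqP->|jn]; last first.
    by apply: hm => //; apply: agree_le h; exact: leq_maxl.
  have := h (pickle (i, n)); rewrite /d pickleK /=; apply.
  exact: leq_maxr.
have dcc i : ccont d (c i).
  move=> x n; have [m hm] := dc i n; exists m => y /hm h j jn.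
  by rewrite h // /d pickleK.
exists d; split=> //; split; last first.
  by move=> U oU; apply: (ccont_copen (dcc 0%N)); case: (cc 0%N) => _; exact.
move=> b hb.
have /choice[x hx] i : exists x, c i x = fun j => b (pickle (i, j)).
  have [ci _] := cc i; apply: ci => n.
  have [m hm] := dc i n; have [y /hm yb] := hb m.
  by exists y => j; exact: yb.
have xx i j : x i = x j.
  apply: hX => A B; rewrite !nbhsE => -[U [oU Ux] UA] [V [oV Vx] VB].
  have [_ /(_ _ oU _ Ux)[n hn]] := cc i; have [_ /(_ _ oV _ Vx)[n' hn']] := cc j.
  have [m hm] := dc i n; have [m' hm'] := dc j n'.
  have [y hy] := hb (maxn m m'); exists y; split.
    apply: UA; apply: hn => l ln; rewrite hx (hm _ b) //.
    by apply: agree_le hy; exact: leq_maxl.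
  apply: VB; apply: hn' => l ln; rewrite hx (hm' _ b) //.
  by apply: agree_le hy; exact: leq_maxr.
exists (x 0%N); apply/funext => k; rewrite /d; case hk : unpickle => [[i j]|].
  rewrite (xx _ i) /= hx.
  have [y hy] := hb (maxn k (pickle (i, j))).+1.
  have e1 := hy k (leq_maxl _ _); have e2 := hy (pickle (i, j)) (leq_maxr _ _).
  by rewrite -e1 -e2 /d hk pickleK.
have [y hy] := hb k.+1; by rewrite -(hy k) // /d hk.
Qed.

(** Coordinate 0 becomes 0 off [U] and, on [U], one plus the least length of a cylinder contained in
    [U]. Recording this length instead of a single bit keeps the set of codes closed: a limit of
    points of [U] with the same length is again in [U]. *)
Lemma coding_adjoin (X : topologicalType) (c : X -> nat -> nat) (U : set X) :
  coding c -> copen c U -> exists d, [/\ coding d, ccont d c & clop d U].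
Proof.
move=> [cC cX] cU; pose P x n := forall y, agree n (c y) (c x) -> U y.
pose d x k := if k is k'.+1 then c x k' else
  if `[< U x >] then (least (P x)).+1 else 0%N.
have dc x n b : agree n.+1 (d x) b -> agree n (c x) (fun k => b k.+1).
  by move=> h k kn; rewrite -h.
have dcc : ccont d c by move=> x n; exists n.+1 => y /dc.
exists d; split=> //; last first.
  move=> x; exists 1%N => y /(_ 0%N isT); rewrite /d.
  by case: asboolP => Uy; case: asboolP => Ux.
split; last by move=> V /cX; exact: ccont_copen.
move=> b hb; have [x xb] : exists x, c x = fun k => b k.+1.
  by apply: cC => n; have [y /dc] := hb n.+1; exists y.
exists x; apply/funext => -[|k]; last by rewrite /= xb.
case b0 : (b 0%N) => [|m].
  rewrite /d; case: asboolP => // Ux; have [n hn] := cU _ Ux.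
  have [y hy] := hb n.+1; have := hy 0%N isT; rewrite b0 /d asboolT //.
  by apply: hn; rewrite xb; exact: dc.
have [y hy] := hb m.+2; have := hy 0%N isT; rewrite b0 /d.
case: asboolP => // Uy [lm]; have [Pl lmin] := leastP (cU _ Uy).
have xy : agree m.+1 (c y) (c x) by rewrite xb; exact: dc.
have PE n : (n <= m)%N -> P y n <-> P x n.
  move=> nm; have xy' := agree_le (leqW nm) xy.
  split=> h z hz; apply: h; apply: agree_trans hz _ => //.
  exact: agree_sym.
rewrite -/(P y) in lm Pl lmin; rewrite lm in Pl lmin.
have Px : P x m by apply/PE.
rewrite asboolT; last by exact: Px.
congr S; apply: least_uniq => // n nm /(PE _ (ltnW nm)).
exact: lmin.
Qed.

(** Open preimages are adjoined, complements keep their coding, and a countable union is open in the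
    join of the codings of its terms, so it can be adjoined. *)
Lemma borel_preimage_clop (X : topologicalType) (c : X -> nat -> nat)
    (p : X -> nat -> bool) B :
  hausdorff_space X -> coding c -> ccont c p -> borel B ->
  exists d, coding d /\ clop d (p @^-1` B).
Proof.
move=> hX cc cp; elim=> [U oU|A _ [d [cd dA]]|A _ IH].
- have [d [cd _ dU]] := coding_adjoin cc (copen_preimage cp oU).
  by exists d.
- exists d; split=> // x; have [n hn] := dA x; exists n => y /hn h.
  by rewrite /preimage /=; split=> nA hA; apply: nA; apply/h.
- have [d hd] := choice IH.
  have [e [ce ed]] := coding_join hX (fun i => (hd i).1).
  have eU : copen e (p @^-1` \bigcup_i A i).
    move=> x [i _ Aix]; have [n hn] := clop_copen (ccont_clop (ed i) (hd i).2) Aix.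
    by exists n => y /hn Aiy; exists i.
  by have [e' [? _ ?]] := coding_adjoin ce eU; exists e'.
Qed.

Lemma borel_preimages_clop (X : topologicalType) (c : X -> nat -> nat)
    (p : X -> nat -> bool) (B : nat -> set (nat -> bool)) :
  hausdorff_space X -> coding c -> ccont c p -> (forall i, borel (B i)) ->
  exists d, [/\ coding d, ccont d c & forall i, clop d (p @^-1` B i)].
Proof.
move=> hX cc cp bB.
have /choice[d hd] i := borel_preimage_clop hX cc cp (bB i).
pose d' i := if i is i'.+1 then d i' else c.
have [|e [ce ed]] := @coding_join X d' hX; first by case=> [|i] //; have [] := hd i.
exists e; split=> // [|i]; first exact: (ed 0%N).
exact: ccont_clop (ed i.+1) (hd i).2.
Qed.

(** * Baire category in the Cantor space *)

(** The condition says that the interior of [V] is dense. *)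
Definition dense_open (V : set (nat -> bool)) :=
  forall x n, exists y, agree n y x /\ exists m, forall z, agree m z y -> V z.

Definition comeager (G : set (nat -> bool)) :=
  exists V : nat -> set (nat -> bool),
    (forall i, dense_open (V i)) /\ forall x, (forall i, V i x) -> G x.

(** This is the Baire category theorem: each step moves to a strictly longer cylinder contained in
    the next [V i], and the nested cylinders determine the point. *)
Lemma comeager_dense G : comeager G -> forall x n, exists y, agree n y x /\ G y.
Proof.
move=> [V [dV VG]] x n.
have /choice[step hstep] (s : nat * ((nat -> bool) * nat)) :
    exists t : (nat -> bool) * nat, [/\ agree s.2.2 t.1 s.2.1, (s.2.2 < t.2)%N &
      forall z, agree t.2 z t.1 -> V s.1 z].
  case: s => i [y m]; have [z [zy [k hk]]] := dV i y m.
  exists (z, maxn m.+1 k); split=> //=; first exact: leq_maxl.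
  by move=> w wz; apply: hk; apply: agree_le wz; exact: leq_maxr.
pose fix st k := if k is k'.+1 then step (k', st k') else (x, n).
have st_lt k : ((st k).2 < (st k.+1).2)%N by have [] := hstep (k, st k).
have st_agree k l : (k <= l)%N -> agree (st k).2 (st l).1 (st k).1.
  have le i j : (i <= j)%N -> ((st i).2 <= (st j).2)%N.
    apply: (@homo_leq _ (fun i => (st i).2) leq leqnn leq_trans) => k'.
    exact: ltnW.
  elim: l => [|l IH]; first by rewrite leqn0 => /eqP->.
  rewrite leq_eqVlt ltnS => /orP[/eqP->//|kl]; apply: agree_trans (IH kl).
  by have [h _ _] := hstep (l, st l); apply: agree_le h; exact: le.
have st_ge k : (k <= (st k).2)%N.
  by elim: k => // k IH; exact: leq_ltn_trans IH (st_lt k).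
pose y i := (st i.+1).1 i.
have yP k : agree (st k).2 y (st k).1.
  move=> i ik; rewrite /y.
  have h := st_agree _ _ (leq_maxl k i.+1); have h' := st_agree _ _ (leq_maxr k i.+1).
  by rewrite -h // h' //; exact: st_ge.
exists y; split; first exact: (yP 0%N).
apply: VG => i; have [_ _] := hstep (i, st i); apply.
exact: (yP i.+1).
Qed.

Lemma comeager_bigcap (I : countType) (G : I -> set (nat -> bool)) :
  (forall i, comeager (G i)) -> comeager (\bigcap_i G i).
Proof.
move=> /choice[V hV].
exists (fun k => if (unpickle k : option (I * nat)) is Some ij then V ij.1 ij.2 else setT).
split=> [k|x hx i _].
  case: unpickle => [[i j]|]; first by have [h _] := hV i; exact: h.
  by move=> x n; exists x; split=> //; exists 0%N.
have [_] := hV i; apply=> j; have := hx (pickle (i, j)).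
by rewrite pickleK.
Qed.

Lemma comeagerI G H : comeager G -> comeager H -> comeager (G `&` H).
Proof.
move=> cG cH; have := @comeager_bigcap bool (fun b => if b then G else H).
have -> : \bigcap_(b : bool) (if b then G else H) = G `&` H.
  apply/seteqP; split=> [x h|x [Gx Hx] [] //].
  by split; [exact: (h true)|exact: (h false)].
by apply; case.
Qed.

(* The Baire property, in the form of relative clopenness in a comeager set. *)
Lemma borel_baire B : borel B -> exists G, comeager G /\
  forall x, G x -> exists n, forall y, G y -> agree n y x -> (B y <-> B x).
Proof.
elim=> [U oU|A _ [G [cG hG]]|A _ /choice[G hG]].
- exists [set x | U x \/ exists n, forall y, agree n y x -> ~ U y]; split.
    exists (fun=> [set x | U x \/ exists n, forall y, agree n y x -> ~ U y]).
    split=> [_ x n|x /(_ 0%N)//].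
    have [[y [yx Uy]]|h] := pselect (exists y, agree n y x /\ U y).
      exists y; split=> //; have [m hm] := oU _ Uy.
      by exists m => z /hm; left.
    exists x; split=> //; exists n => z zx; right; exists n => y yz Uy.
    by apply: h; exists y; split=> //; exact: agree_trans zx.
  move=> x [Ux|[n hn]].
    by have [n hn] := oU _ Ux; exists n => y _ /hn.
  by exists n => y _ /hn nUy; split=> // Ux; case: (hn x).
- exists G; split=> // x /hG[n hn]; exists n => y Gy /(hn _ Gy) e.
  by split=> nA /e.
- pose G' := \bigcap_i G i.
  have cG' : comeager G' by apply: comeager_bigcap => i; have [] := hG i.
  (* Points near which the union holds throughout [G'] or fails throughout [G']. Where it holds at
     one point of [G'], the hypothesis on that [A i] spreads it to a cylinder. *)
  pose D := [set x | exists n, (forall y, G' y -> agree n y x -> (\bigcup_i A i) y) \/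
                               (forall y, G' y -> agree n y x -> ~ (\bigcup_i A i) y)].
  exists (G' `&` D); split.
    apply: comeagerI => //; exists (fun=> D); split=> [_ x n|x /(_ 0%N)//].
    have [[y [yx [Gy [i _ Ay]]]]|h] :=
        pselect (exists y, agree n y x /\ G' y /\ (\bigcup_i A i) y); last first.
      exists x; split=> //; exists n => z zx; exists n; right=> y Gy yz Ay.
      by apply: h; exists y; split=> //; exact: agree_trans zx.
    exists y; split=> //; have [_ /(_ y (Gy i I))[m hm]] := hG i.
    exists m => z zy; exists m; left=> w Gw wz; exists i => //.
    by apply/(hm w (Gw i I)) => //; exact: agree_trans zy.
  move=> x [Gx [n [hn|hn]]]; exists n => y [Gy _] yx.
    by split=> _; exact: hn.
  by split=> h; exfalso; move: h; exact: hn.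
Qed.

Definition flip k (x : nat -> bool) : nat -> bool := upd x k (~~ x k).

Lemma flipE k x i : flip k x i = (i == k) (+) x i.
Proof. by rewrite /flip /upd; case: eqP => [->|]. Qed.

Lemma flipK k : involutive (flip k).
Proof. by move=> x; apply/funext => i; rewrite !flipE addbA addbb. Qed.

Lemma agree_flip k n x y : agree n x y -> agree n (flip k x) (flip k y).
Proof. by move=> h i ni; rewrite !flipE h. Qed.

Lemma comeager_flip k G : comeager G -> comeager (flip k @^-1` G).
Proof.
move=> [V [dV VG]]; exists (fun i => flip k @^-1` V i); split=> [i x n|x h]; last exact: VG.
have [y [yx [m hm]]] := dV i (flip k x) n.
exists (flip k y); split; first by rewrite -[x](flipK k); exact: agree_flip.
by exists m => z /(agree_flip k); rewrite flipK; exact: hm.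
Qed.

(** * The graph s(G_0) *)

Lemma size_words k w : w \in words k -> size w = k.
Proof.
elim: k w => [|k IH] w /=; first by rewrite inE => /eqP->.
by rewrite mem_cat => /orP[] /mapP[v /IH <- ->].
Qed.

Lemma mem_words w : w \in words (size w).
Proof.
elim: w => [|b w IH] //=; rewrite mem_cat.
by case: b; rewrite map_f ?orbT.
Qed.

Lemma size_psi n : (size (psi n) <= n)%N.
Proof.
rewrite /psi; set l := flatten _; have [nl|ln] := ltnP n (size l); last first.
  by rewrite nth_default.
have /flattenP[u /mapP[k kn ->] /size_words ->] := mem_nth [::] nl.
by move: kn; rewrite mem_iota ltnS => /andP[].
Qed.

Lemma size_s_ n : size (s_ n) = n.
Proof. by rewrite size_cat size_nseq subnKC // size_psi. Qed.

(** The words of length [size w] start at position [len (size w)] of the enumeration. As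
    [m <= len m], this position is at least [size w], so the finite list in [psi] is long enough to
    reach [w]. *)
Lemma psi_surj w : exists2 n, (size w <= n)%N & psi n = w.
Proof.
pose len m := size (flatten [seq words k | k <- iota 0 m]).
have len_ge m : (m <= len m)%N.
  elim: m => // m IH; rewrite /len -addn1 iotaD map_cat flatten_cat size_cat.
  apply: leq_add => //=; rewrite cats0 add0n.
  by have := mem_words (nseq m false); rewrite size_nseq; case: words.
exists (len (size w) + index w (words (size w)))%N.
  by apply: leq_trans (len_ge _) (leq_addr _ _).
set n := (_ + _)%N.
have wn : (size w <= n)%N by apply: leq_trans (len_ge _) (leq_addr _ _).
have -> : psi n = nth [::] (flatten [seq words k | k <- iota 0 (size w + (n - size w).+1)]) n.
  by rewrite addnS subnKC.
rewrite iotaD map_cat flatten_cat nth_cat ltnNge leq_addr /= add0n addKn.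
by rewrite nth_cat index_mem mem_words nth_index // mem_words.
Qed.

Lemma s_dense (x : nat -> bool) m :
  exists2 n, (m <= n)%N & agree m (nth false (s_ n)) x.
Proof.
have [n] := psi_surj (mkseq x m); rewrite size_mkseq => mn pn.
exists n => // i im; rewrite /s_ pn nth_cat size_mkseq im nth_mkseq //.
Qed.

(* The graph s(G_0); since [s_ k] has length [k], the index [k] of an edge is also
   the position at which its endpoints differ. *)
Definition sG0 (x y : nat -> bool) :=
  exists k, y = flip k x /\ agree k x (nth false (s_ k)).

Lemma symmetrization_G0 x y : symmetrization G0 (x, y) <-> sG0 x y.
Proof.
have sz k b : size (rcons (s_ k) b) = k.+1 by rewrite size_rcons size_s_.
have pre k b g i : prepend (rcons (s_ k) b) g i =
    if (i < k)%N then nth false (s_ k) i else if i == k then b else g (i - k.+1)%N.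
  rewrite /prepend sz nth_rcons size_s_; case: ltnP => // ik.
  by apply: set_nth_default; rewrite size_s_.
have fl k b g : prepend (rcons (s_ k) (~~ b)) g = flip k (prepend (rcons (s_ k) b) g).
  apply/funext => i; rewrite flipE !pre; case: ltnP => ik; last by case: eqP.
  by rewrite ltn_eqF.
have ag k b g : agree k (prepend (rcons (s_ k) b) g) (nth false (s_ k)).
  by move=> i ik; rewrite pre ik.
split.
  by move=> [] [k [g [-> ->]]]; exists k; split=> //; rewrite -fl.
move=> [k [-> xk]].
have xE : x = prepend (rcons (s_ k) (x k)) (fun i => x (i + k.+1)%N).
  apply/funext => i; rewrite pre; case: ltnP => ik; first exact: xk.
  by case: eqP => [->//|/eqP ik']; rewrite subnK // ltn_neqAle eq_sym ik'.
have fE : flip k x = prepend (rcons (s_ k) (~~ x k)) (fun i => x (i + k.+1)%N).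
  by rewrite fl -xE.
(* The bit [x k] tells in which orientation the edge belongs to [G0]. *)
case xk0 : (x k) xE fE => xE fE; [right|left]; exists k, (fun i => x (i + k.+1)%N).
  by congr (_, _); [exact: fE|exact: xE].
by congr (_, _); [exact: xE|exact: fE].
Qed.

Lemma sG0_flip k x : agree k x (nth false (s_ k)) -> sG0 x (flip k x).
Proof. by exists k. Qed.

Lemma sG0_irrefl x : ~ sG0 x x.
Proof.
move=> [k [/(congr1 (fun u : nat -> bool => u k)) + _]].
by rewrite flipE eqxx addTb; case: (x k).
Qed.

(** Near two points that first differ at [k], an edge must have index [k]; membership is then a
    closed condition. *)
Lemma sG0_closed x y : x <> y -> ~ sG0 x y ->
  exists n, forall x' y', agree n x' x -> agree n y' y -> ~ sG0 x' y'.
Proof.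
move=> xy nxy.
have /exists_least[k [xyk kmin]] : exists k, x k <> y k.
  by apply: contrapT => /forallNP h; apply: xy; apply/funext => i; apply: contrapT.
have fk x' y' : agree k.+1 x' x -> agree k.+1 y' y -> sG0 x' y' ->
    y' = flip k x' /\ agree k x (nth false (s_ k)).
  move=> xx yy [l [e h]]; have [lk|kl|lk] := ltngtP l k.
  - have : x' l = y' l.
      by rewrite xx ?yy ?ltnS ?(ltnW lk) //; apply: contrapT; exact: kmin.
    by rewrite e flipE eqxx; case: (x' l).
  - by case: xyk; rewrite -xx // -yy // e flipE (ltn_eqF kl).
  - subst l; split=> //; apply: agree_trans h; apply: agree_sym.
    by apply: (agree_le (leqnSn _)); exact: xx.
have [ak|ak] := pselect (agree k x (nth false (s_ k))); last first.
  by exists k.+1 => x' y' xx yy /(fk _ _ xx yy)[].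
have : y <> flip k x by move=> e; apply: nxy; exists k.
move=> h; have [j hj] : exists j, y j <> flip k x j.
  by apply: contrapT => /forallNP h'; apply: h; apply/funext => i; apply: contrapT.
exists (maxn k.+1 j.+1) => x' y' xx yy /fk[||e _].
- by apply: agree_le xx; exact: leq_maxl.
- by apply: agree_le yy; exact: leq_maxl.
- apply: hj; have jm : (j < maxn k.+1 j.+1)%N by exact: leq_maxr.
  by rewrite -yy // e !flipE xx.
Qed.

Definition shift (x : nat -> bool) : nat -> bool := fun i => x i.+1.

Definition scons (b : bool) (x : nat -> bool) : nat -> bool :=
  fun i => if i is i'.+1 then x i' else b.

Lemma scons_shift x : scons (x 0%N) (shift x) = x.
Proof. by apply/funext => -[]. Qed.

Lemma ccont_scons b : ccont id (scons b).
Proof. by move=> x n; exists n => y h [|i] // /ltnW; exact: h. Qed.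

Lemma prepend1 b x : prepend [:: b] x = scons b x.
Proof. by apply/funext => -[|i] //=; rewrite /prepend /= subn1 nth_nil. Qed.

Definition graph_over (Q : bool -> bool -> bool) :
    set (cantor_space * cantor_space) :=
  [set p | Q (p.1 0%N) (p.2 0%N) /\ sG0 (shift p.1) (shift p.2)].

Lemma G_sG0E : G_sG0 = graph_over (fun a b => ~~ a && b).
Proof.
apply/seteqP; split=> [_ [a [b [/symmetrization_G0 ab ->]]]|[x y] [/= /andP[x0 y0] h]].
  by rewrite !prepend1.
exists (shift x), (shift y); split; first exact/symmetrization_G0.
by rewrite !prepend1 -{1}(scons_shift x) -{1}(scons_shift y) (negbTE x0) y0.
Qed.

Lemma symmetrization_T0E :
  symmetrization T0 = graph_over (fun a b => a != b).
Proof.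
apply/seteqP; split=> [[x y]|[x y] [/= xy /symmetrization_G0 h]].
  by move=> [] [e [a [b [ab [-> ->]]]]]; rewrite !prepend1; split=> /=;
    [case: e|apply/symmetrization_G0; left|case: e|apply/symmetrization_G0; right].
have xE := scons_shift x; have yE := scons_shift y.
have [xN yN] : x 0%N = ~~ y 0%N /\ y 0%N = ~~ x 0%N.
  by move: xy; case: (x _); case: (y _).
case: h => h; [left; exists (x 0%N), (shift x), (shift y)|
  right; exists (y 0%N), (shift y), (shift x)]; split=> //;
  by rewrite !prepend1 -?yN -?xN xE yE.
Qed.

(** * Failure of potential closedness by Baire category *)

Section not_pot_closed.
Variables (R : realType) (Q : bool -> bool -> bool).
Hypothesis Q01 : Q false true.

Lemma graph_over_not_pot_closed : ~ pot_closed R (graph_over Q).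
Proof.
move=> /pot_closed_coding[c [c' [cc cc' cE]]].
have bcyl (d : cantor_space -> nat -> nat) b n a :
    coding d -> borel (scons b @^-1` cyl d n a).
  move=> [dC dU]; apply: borel_preimage; first exact: ccont_scons.
  have -> : cyl d n a = id @` cyl d n a by rewrite image_id.
  apply: (@lusin_souslin _ d id) => // x m.
  have oU : open [set y : cantor_space | agree m y x].
    by apply/cantor_openP => y yx; exists m => z /agree_trans; exact.
  by have [k hk] := dU _ oU x (fun i _ => erefl); exists k.
(* [E st] collects the [y] for which the pair of [scons false y] and [scons true y] lies in a basic
   box of the two finer topologies. *)
pose E (st : seq nat * seq nat) : set (nat -> bool) :=
  scons false @^-1` cyl c (size st.1) (nth 0%N st.1) `&`
  scons true @^-1` cyl c' (size st.2) (nth 0%N st.2).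
have /choice[G hG] st : exists G, comeager G /\
    forall x, G x -> exists n, forall y, G y -> agree n y x -> (E st y <-> E st x).
  by apply: borel_baire; apply: borelI; exact: bcyl.
have cG : comeager (\bigcap_st G st) by apply: comeager_bigcap => st; have [] := hG st.
have [x [_ Gx]] := comeager_dense cG (fun=> false) 0%N.
have [|n hn] := cE (scons false x) (scons true x); first by move=> [_ /= /sG0_irrefl].
pose st := (mkseq (c (scons false x)) n, mkseq (c' (scons true x)) n).
have Est y : E st y -> agree n (c (scons false y)) (c (scons false x)) /\
    agree n (c' (scons true y)) (c' (scons true x)).
  rewrite /E /cyl /= !size_mkseq => -[h1 h2].
  by split=> i ni; [rewrite h1 // nth_mkseq|rewrite h2 // nth_mkseq].
have Ex : E st x.
  by rewrite /E /cyl /= !size_mkseq; split=> i ni; rewrite nth_mkseq.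
have [_ /(_ x (Gx st I))[m hm]] := hG st.
(* An index [k >= m] with [s_ k] in the cylinder of [x] gives edges inside that cylinder. A generic
   [y] extending [s_ k] has both [y] and [flip k y] in the comeager set, hence in [E st], so the box
   meets the relation. *)
have [k mk kx] := s_dense x m.
have [y [yk [Gy Gy']]] := comeager_dense (comeagerI cG (comeager_flip k cG))
  (nth false (s_ k)) k.
have yx : agree m y x by apply: agree_trans kx; exact: agree_le yk.
have y'x : agree m (flip k y) x.
  by move=> i im; rewrite flipE ltn_eqF ?(leq_trans im) //; exact: yx.
have /Est[h1 _] : E st y by apply/(hm y (Gy st I)).
have /Est[_ h2] : E st (flip k y) by apply/(hm _ (Gy' st I)).
apply: (hn _ _ h1 h2); split=> //=.
exact: sG0_flip.
Qed.

End not_pot_closed.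

(** * Finite approximations *)

(** Addition modulo 2 of the bits of [s] to [z] at the positions [m k], for [m] injective below
    [size s]. *)
Definition spread (m : nat -> nat) (z : nat -> bool) (s : seq bool) : nat -> bool :=
  fun i => z i (+) has (fun k => (m k == i) && nth false s k) (iota 0 (size s)).

Lemma eq_spread m m' z s :
  agree (size s) m m' -> spread m z s = spread m' z s.
Proof.
move=> mm; apply/funext => i; congr (_ (+) _); apply: eq_in_has => k.
by rewrite mem_iota => /andP[_ /mm ->].
Qed.

Lemma agree_spread m z z' s n :
  agree n z z' -> agree n (spread m z s) (spread m z' s).
Proof. by move=> h i ni; rewrite /spread h. Qed.

Lemma spread_flip m z s q : spread m (flip q z) s = flip q (spread m z s).
Proof. by apply/funext => i; rewrite flipE /spread flipE addbA. Qed.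

Lemma spreadK m s : involutive (fun z => spread m z s).
Proof. by move=> z; apply/funext => i; rewrite /spread -addbA addbb addbF. Qed.

Lemma spread_nil m z : spread m z [::] = z.
Proof. by apply/funext => i; rewrite /spread addbF. Qed.

Lemma spread_rcons m z s b :
  (forall k, (k < size s)%N -> m k <> m (size s)) ->
  spread m z (rcons s b) =
    if b then flip (m (size s)) (spread m z s) else spread m z s.
Proof.
move=> hm; apply/funext => i; rewrite /spread size_rcons -addn1 iotaD has_cat /=.
rewrite add0n orbF nth_rcons ltnn eqxx.
have -> : has (fun k => (m k == i) && nth false (rcons s b) k) (iota 0 (size s)) =
    has (fun k => (m k == i) && nth false s k) (iota 0 (size s)).
  by apply: eq_in_has => k; rewrite mem_iota => /andP[_ ks]; rewrite nth_rcons ks.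
case: b; last by rewrite andbF orbF.
rewrite flipE andbT eq_sym; case: eqP => [->|_]; last by rewrite orbF.
rewrite orbT [has _ _](_ : _ = false) ?addbF ?addbT //.
apply/hasPn => k; rewrite mem_iota => /andP[_ /hm mk].
by rewrite negb_and; apply/orP; left; apply/eqP.
Qed.

Lemma ccont_spread m s : ccont id (fun z => spread m z s).
Proof. by move=> z n; exists n => z'; exact: agree_spread. Qed.

Lemma borel_spread (m : nat -> nat) s B :
  borel B -> borel ((fun z => spread m z s) @^-1` B).
Proof. exact/borel_preimage/ccont_spread. Qed.

Definition independent (B : set (nat -> bool)) :=
  forall x y, B x -> B y -> ~ sG0 x y.

Definition cosmall (Y : set (nat -> bool)) :=
  exists B : nat -> set (nat -> bool),
    [/\ forall i, borel (B i), forall i, independent (B i) & Y = ~` \bigcup_i B i].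

Lemma cosmall_borel Y : cosmall Y -> borel Y.
Proof. by move=> [B [bB _ ->]]; apply: borelC; exact: borel_bigcup. Qed.

Lemma cosmall_bigcap (J : countType) (Y : J -> set (nat -> bool)) :
  (forall i, cosmall (Y i)) -> cosmall (\bigcap_i Y i).
Proof.
move=> /choice[B hB].
exists (fun n => if (unpickle n : option (J * nat)) is Some ij then B ij.1 ij.2 else set0).
split=> [n|n|].
- by case: unpickle => [[i j]|]; [have [h _ _] := hB i; exact: h|exact: borel0].
- by case: unpickle => [[i j]|]; [have [_ h _] := hB i; exact: h|].
- apply/seteqP; split=> [x h [n _]|x h i _].
    case: unpickle => [[i j]|] //= Bx; have := h i I; have [_ _ ->] := hB i.
    by apply; exists j.
  have [_ _ ->] := hB i; move=> [j _ Bx]; apply: h.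
  by exists (pickle (i, j)) => //; rewrite pickleK.
Qed.

Lemma cosmallD Y B : cosmall Y -> borel B -> independent B -> cosmall (Y `\` B).
Proof.
move=> cY bB iB; have cB : cosmall (~` B).
  exists (fun=> B); split=> //; congr (~` _).
  by apply/seteqP; split=> [x Bx|x [_ _]//]; exists 0%N.
have -> : Y `\` B = \bigcap_(b : bool) (if b then Y else ~` B).
  apply/seteqP; split=> [x [Yx nBx] [] //|x h].
  by split; [exact: (h true I)|exact: (h false I)].
by apply: cosmall_bigcap => -[].
Qed.

(** * Extending approximations along edges *)

Section dichotomy.
Variables (X : topologicalType) (c : X -> nat -> nat) (f : X -> nat -> bool).
Hypotheses (cC : cclosed c) (cf : ccont c f) (fI : injective f).

(* A finite approximation of the embedding: [s], of length [n], is sent to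
   [spread m z s], which must have lifts to [X] through [f] over both
   [false] and [true]; [m n] is a lower bound for the next label. *)
Record config (n : nat) (Y : set (nat -> bool)) (m : nat -> nat)
    (z : nat -> bool) (x : seq bool -> X) : Prop := Config {
  config_lt : forall i j, (i < j)%N -> (j <= n)%N -> (m i < m j)%N ;
  config_s : forall k, (k < n)%N ->
    agree (m k) (spread m z (s_ k)) (nth false (s_ (m k))) ;
  config_f : forall b s, size s = n -> f (x (b :: s)) = scons b (spread m z s) ;
  config_in : forall s, size s = n -> Y (spread m z s) }.

(* There are only countably many keys, so being realized in every cosmall set can
   be decided for all of them at once inside a single cosmall set. *)
Definition key n (m : nat -> nat) (z : nat -> bool) (x : seq bool -> X) :
    seq nat * seq bool * seq (seq nat) :=
  (mkseq m n.+1, mkseq z (m n), [seq mkseq (c (x v)) n | v <- words n.+1]).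

Lemma keyP n m z x m' z' x' : key n m z x = key n m' z' x' <->
  [/\ agree n.+1 m m', agree (m n) z z' &
      forall v, size v = n.+1 -> agree n (c (x v)) (c (x' v))].
Proof.
split=> [e|[hm hz hx]].
- have hm : agree n.+1 m m' by apply/mkseq_agree; exact: (congr1 (fun p => p.1.1) e).
  have hz : mkseq z (m n) = mkseq z' (m' n) by exact: (congr1 (fun p => p.1.2) e).
  have /eq_in_map hx := congr1 snd e; split=> //.
    by move: hz; rewrite -hm // => /mkseq_agree.
  by move=> v vn; have := mem_words v; rewrite vn => /hx /(eq_codeP c).
- rewrite /key; congr (_, _, _); first exact/mkseq_agree.
    by rewrite -(hm n) //; exact/mkseq_agree.
  by apply/eq_in_map => v /size_words/hx/(eq_codeP c).
Qed.

Definition good n kappa := forall Y, cosmall Y ->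
  exists m z x, config n Y m z x /\ key n m z x = kappa.

(** The images of [s_ n] under the approximations with key [kappa]; an edge between two of them is
    what joins two approximations into one of level [n.+1]. *)
Let A n Y kappa := [set y | exists m z x,
  [/\ config n Y m z x, key n m z x = kappa & y = spread m z (s_ n)]].

(** Relative to one fixed realization, the key freezes the labels, so [z] is recovered from [y] by
    the involution [spread]. What remains says that certain translates of [z] lie in [Y] and have
    lifts in given cylinders, which is Borel by [lusin_souslin]. *)
Let A_borel n Y kappa : cosmall Y -> borel (A n Y kappa).
Proof.
move=> cY; have [[_ [m0 [z0 [x0 [h0 k0 _]]]]]|A0] :=
    pselect (exists y, A n Y kappa y); last first.
  have -> : A n Y kappa = set0 by apply/seteqP; split=> // y Ay; apply: A0; exists y.
  exact: borel0.
pose P (bs : bool * seq bool) : set (nat -> bool) :=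
  if size bs.2 == n then (fun z => spread m0 z bs.2) @^-1`
    (scons bs.1 @^-1` (f @` cyl c n (c (x0 (bs.1 :: bs.2)))) `&` Y) else setT.
have -> : A n Y kappa = (fun y => spread m0 y (s_ n)) @^-1`
    ([set z | agree (m0 n) z z0] `&` \bigcap_bs P bs).
  apply/seteqP; split=> y.
    move=> [m [z [x [[h1 h2 h3 h4] hk ->]]]].
    move: hk; rewrite -k0 => /keyP[km kz kx].
    have sE s : size s = n -> spread m z s = spread m0 z s.
      by move=> sn; apply: eq_spread; rewrite sn; exact: agree_le km.
    rewrite /preimage /= sE ?size_s_ // spreadK -(km n) //; split=> // -[b s] _.
    rewrite /P /=; case: eqP => // sn; rewrite /preimage /= -sE //; split.
      by exists (x (b :: s)); [apply: kx; rewrite /= sn|exact: h3].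
    exact: h4.
  move=> [/= hz hP]; set z := spread m0 y (s_ n) in hz hP *.
  have /choice[x hx] v : exists u, size v = n.+1 ->
      agree n (c u) (c (x0 v)) /\ f u = scons (head false v) (spread m0 z (behead v)).
    case: v => [|b s] /=; first by exists (x0 [::]).
    have := hP (b, s) I; rewrite /P /=; case: eqP => sn; last first.
      by move=> _; exists (x0 [::]) => -[].
    by move=> [[u hu fu] _]; exists u.
  exists m0, z, x; split.
  - split.
    + exact: config_lt h0.
    + move=> k kn; apply: agree_trans (config_s h0 kn).
      apply: agree_spread; apply: agree_le hz; apply: ltnW.
      exact: config_lt h0 _ _ kn (leqnn _).
    + by move=> b s sn; have [|_ ->] := hx (b :: s) => //=; rewrite sn.
    + by move=> s sn; have := hP (true, s) I; rewrite /P /= sn eqxx => -[].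
  - rewrite -k0; apply/keyP; split=> // v vn.
    by have [] := hx v vn.
  - by rewrite /z spreadK.
apply: borel_spread; apply: borelI.
  by apply: borel_open => z hz; exists (m0 n) => z' /agree_trans; exact.
apply: borel_bigcap => -[b s]; rewrite /P; case: eqP => /= sn; last first.
  exact: borelT.
apply: borel_spread; apply: borelI; last exact: cosmall_borel.
by apply: borel_preimage; [exact: ccont_scons|exact: lusin_souslin].
Qed.

Definition link n m0 (z0 : nat -> bool) (x0 : seq bool -> X) m z (x : seq bool -> X) :=
  [/\ agree n m m0, (m0 n <= m n)%N, agree (m0 n) z z0 &
   forall v b, size v = n.+1 -> agree n (c (x (rcons v b))) (c (x0 v))].

(** If the Borel set [A] were independent, deleting it from [Y] would leave a cosmall set where the
    key is not realized. So [A] contains an edge, and its two approximations become the halves of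
    the new one, selected by the last bit. *)
Lemma good_extend n m0 z0 x0 Y : good n (key n m0 z0 x0) -> cosmall Y ->
  exists m z x, config n.+1 Y m z x /\ link n m0 z0 x0 m z x.
Proof.
move=> gk cY.
have [y [y' [Ay Ay' [q [e yq]]]]] : exists y y',
    [/\ A n Y (key n m0 z0 x0) y, A n Y (key n m0 z0 x0) y' & sG0 y y'].
  apply: contrapT => hA.
  have iA : independent (A n Y (key n m0 z0 x0)).
    by move=> y y' Ay Ay' yy'; apply: hA; exists y, y'.
  have [m [z [x [[h1 h2 h3 h4] hk]]]] := gk _ (cosmallD cY (A_borel _ _ cY) iA).
  have [_] := h4 _ (size_s_ n); apply; exists m, z, x; split=> //.
  by split=> // s /h4[].
move: Ay Ay' => [m [z [x [hc hk yE]]]] [m' [z' [x' [hc' hk' yE']]]].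
have /keyP[mm zz xx] : key n m z x = key n m' z' x' by rewrite hk hk'.
have sE s w : size s = n -> spread m' w s = spread m w s.
  by move=> sn; apply/esym/eq_spread; rewrite sn; exact: agree_le mm.
have z'E : z' = flip q z.
  move: e; rewrite yE yE' sE ?size_s_ // -spread_flip => h.
  exact: (can_inj (spreadK m (s_ n))) h.
(* Equal keys make [z] and [z'] agree below [m n], so the position [q] where they differ is not
   below it. *)
have mq : (m n <= q)%N.
  rewrite leqNgt; apply/negP => /zz; rewrite z'E flipE eqxx.
  by case: (z q).
(* The index [q] of the edge becomes the label number [n], and [q.+1] the lower bound for the next
   label. *)
pose M i := if (i < n)%N then m i else if i == n then q else q.+1.
have Mlt i : (i < n)%N -> M i = m i by rewrite /M => ->.
have Mn : M n = q by rewrite /M ltnn eqxx.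
have MS : M n.+1 = q.+1 by rewrite /M ltnNge leqnSn /= gtn_eqF.
pose x1 w := let v := take n.+1 w in if last false w then x' v else x v.
have x1E v b : size v = n.+1 -> x1 (rcons v b) = if b then x' v else x v.
  by move=> vn; rewrite /x1 last_rcons -cats1 take_size_cat.
have Minc i j : (i < j)%N -> (j <= n.+1)%N -> (M i < M j)%N.
  move=> ij; rewrite leq_eqVlt => /orP[/eqP jE|].
    rewrite jE MS ltnS; move: ij; rewrite jE ltnS leq_eqVlt => /orP[/eqP->|i_n].
      by rewrite Mn.
    by rewrite Mlt //; apply: ltnW; apply: leq_trans mq; exact: config_lt hc _ _ i_n (leqnn _).
  rewrite ltnS leq_eqVlt => /orP[/eqP jE|jn].
    rewrite jE Mn Mlt -?jE //; apply: leq_trans mq.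
    by apply: (config_lt hc) => //; rewrite -jE.
  by rewrite !Mlt // ?(ltn_trans ij) //; apply: (config_lt hc) => //; exact: ltnW.
have ME s w : (size s <= n)%N -> spread M w s = spread m w s.
  by move=> sn; apply: eq_spread => i /leq_trans/(_ sn)/Mlt.
have MR s b : size s = n -> spread M z (rcons s b) =
    if b then spread m' z' s else spread m z s.
  move=> sn; rewrite spread_rcons; last first.
    by move=> k ks h; have := @Minc _ _ ks; rewrite h ltnn sn leqnSn => /(_ isT).
  by rewrite ME ?sn // Mn; case: b => //; rewrite z'E sE // spread_flip.
exists M, z, x1; split.
- split=> //.
  + move=> k; rewrite ltnS leq_eqVlt => /orP[/eqP->|kn].
      by rewrite Mn ME ?size_s_ // -yE.
    rewrite Mlt // ME ?size_s_ ?(ltnW kn) //.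
    exact: config_s hc _ kn.
  + move=> b s; case/lastP: s => // s d; rewrite size_rcons => -[sn].
    rewrite -rcons_cons x1E /= ?sn // MR //.
    by case: d; [exact: config_f hc' _ _ sn|exact: config_f hc _ _ sn].
  + move=> s; case/lastP: s => // s d; rewrite size_rcons => -[sn].
    rewrite MR //.
    by case: d; [exact: config_in hc' _ sn|exact: config_in hc _ sn].
- have /keyP[km kz kx] := hk; have /keyP[km' kz' kx'] := hk'.
  split.
  + by move=> i i_n; rewrite Mlt // km // ltnS ltnW.
  + by rewrite Mn -km.
  + by rewrite -km.
  + by move=> v b vn; rewrite x1E //; case: b; [exact: kx'|exact: kx].
Qed.

(** With [m 0 = 0], every approximation of level 0 has this key. If it fails in some cosmall set, no
    point of that set has both lifts, so the removed independent sets cover all points that do. *)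
Lemma not_good_cover :
  ~ good 0 ([:: 0%N], [::], [:: [::]; [::]]) ->
  exists B : nat -> set (nat -> bool), [/\ forall i, borel (B i),
    forall i, independent (B i) & forall z x0 x1,
      f x0 = scons false z -> f x1 = scons true z -> exists i, B i z].
Proof.
move=> /existsNP[Y /not_implyP[[B [bB iB ->]] h]]; exists B; split=> // z x0 x1 e0 e1.
apply: contrapT => hz; apply: h.
exists id, z, (fun v => if head false v then x1 else x0); split=> //; split=> //.
- by move=> b [] // _; rewrite spread_nil; case: b.
- by move=> [] // _; rewrite spread_nil => -[i _ Bi]; apply: hz; exists i.
Qed.

End dichotomy.

(** * Passing to the limit *)

Section limit_embedding.
Variables (m : nat -> nat) (z : nat -> bool).
Hypothesis m_inc : forall i j, (i < j)%N -> (m i < m j)%N.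

Let m_inj i j : m i = m j -> i = j.
Proof.
by have [/m_inc|/m_inc|//] := ltngtP i j => + e; rewrite e ltnn.
Qed.

Let m_ge i : (i <= m i)%N.
Proof. by elim: i => // i IH; apply: leq_ltn_trans IH (m_inc (ltnSn i)). Qed.

(** The search may stop at [i] because an increasing [m] satisfies [k <= m k]. *)
Definition bits (x : nat -> bool) (i : nat) : bool :=
  has (fun k => (m k == i) && x k) (iota 0 i.+1).

Lemma bits_at x k : bits x (m k) = x k.
Proof.
apply/hasP/idP => [[j _ /andP[/eqP/m_inj -> //]]|xk].
exists k; last by rewrite eqxx.
by rewrite mem_iota ltnS m_ge.
Qed.

Lemma bits_out x i : (forall k, m k <> i) -> bits x i = false.
Proof. by move=> h; apply/hasPn => k _; rewrite (negbTE (introN eqP (h k))). Qed.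

Lemma bits_spread (m' : nat -> nat) (z' : nat -> bool) (s : seq bool) i :
  agree (size s) m' m ->
  spread m' z' s i = z' i (+) bits (nth false s) i.
Proof.
move=> mm; congr (_ (+) _); apply/hasP/hasP => -[k].
  rewrite mem_iota => /andP[_ ks]; rewrite mm // => /andP[/eqP mk sk].
  exists k; last by rewrite mk eqxx.
  by rewrite mem_iota ltnS -mk m_ge.
move=> _ /andP[mk sk].
have ks : (k < size s)%N by rewrite ltnNge; apply/negP => h; rewrite nth_default in sk.
by exists k; [rewrite mem_iota|rewrite mm // mk].
Qed.

Definition embed (x : nat -> bool) : nat -> bool := fun i => z i (+) bits x i.

Lemma embed_inj : injective embed.
Proof.
move=> x y e; apply/funext => k.
by have /addbI := congr1 (fun u : nat -> bool => u (m k)) e; rewrite !bits_at.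
Qed.

Lemma embed_flip k x : embed (flip k x) = flip (m k) (embed x).
Proof.
apply/funext => i; rewrite flipE /embed.
have [[j <-]|h] := pselect (exists j, m j = i).
  rewrite !bits_at flipE addbCA; congr (_ (+) _).
  by apply/eqP/eqP => [->|/m_inj].
have hi j : m j <> i by move=> e; apply: h; exists j.
by rewrite !bits_out // addbF; case: eqP => // /esym/hi.
Qed.

Hypothesis m_s : forall k,
  agree (m k) (embed (nth false (s_ k))) (nth false (s_ (m k))).

(** By [m_s], the word [s_ (m k)] is below [m k] the image of [s_ k]. Images agree automatically off
    the labels, and the labels below [m k] are the [m j] with [j < k]. *)
Lemma agree_embed k x : agree (m k) (embed x) (nth false (s_ (m k))) <->
  agree k x (nth false (s_ k)).
Proof.
split=> h.
  move=> j jk; have := h _ (m_inc jk); rewrite -m_s ?m_inc // => /addbI.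
  by rewrite !bits_at.
apply: agree_trans (@m_s k) => i ik; congr (_ (+) _).
have [[j jE]|h'] := pselect (exists j, m j = i); last first.
  by rewrite !bits_out // => j e; apply: h'; exists j.
rewrite -jE !bits_at; apply: h; rewrite ltnNge leq_eqVlt; apply/negP.
move=> /orP[/eqP e|/m_inc]; first by rewrite -jE e ltnn in ik.
by rewrite jE ltnNge ltnW.
Qed.

(** Two images can differ only at labels, so the index of an edge between them is some [m k]. *)
Lemma sG0_embed x y : sG0 (embed x) (embed y) <-> sG0 x y.
Proof.
split=> [[q [e hq]]|[k [-> xk]]]; last first.
  by exists (m k); rewrite embed_flip; split=> //; exact/agree_embed.
have [[k kq]|h] := pselect (exists k, m k = q).
  move: e hq; rewrite -kq -embed_flip => /embed_inj -> hq.
  by exists k; split=> //; exact/agree_embed.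
have := congr1 (fun u : nat -> bool => u q) e; rewrite flipE eqxx /embed !bits_out.
- by case: (z q).
- by move=> k kq; apply: h; exists k.
- by move=> k kq; apply: h; exists k.
Qed.

End limit_embedding.

Section good_embedding.
Variables (X : topologicalType) (c : X -> nat -> nat) (f : X -> nat -> bool).
Hypotheses (cC : cclosed c) (cf : ccont c f) (fI : injective f).

Lemma good_embedding : good c f 0 ([:: 0%N], [::], [:: [::]; [::]]) ->
  exists (g : (nat -> bool) -> nat -> bool) (h : bool -> (nat -> bool) -> X),
  [/\ injective g, forall x y, sG0 (g x) (g y) <-> sG0 x y,
      forall b x, f (h b x) = scons b (g x) &
      forall b x y n, agree n y x -> agree n (c (h b y)) (c (h b x))].
Proof.
move=> good0.
pose K : countType := (nat * (seq nat * seq bool * seq (seq nat)))%type.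
(* For each key that is not good, choose a cosmall set in which it is not realized. In the
   intersection of these countably many sets, every realized key is good, so the extension never
   gets stuck. *)
have /choice[Yk hYk] (nk : K) : exists Y, cosmall Y /\
    (~ good c f nk.1 nk.2 -> forall m z x, config f nk.1 Y m z x ->
       key c nk.1 m z x <> nk.2).
  have [gk|/existsNP[Y /not_implyP[cY hY]]] := pselect (good c f nk.1 nk.2).
    exists setT; split=> //; exists (fun=> set0).
    split=> [_|_ x y []|]; first exact: borel0.
    by rewrite bigcup0 // setC0.
  exists Y; split=> // _ m z x hc hk; apply: hY.
  by exists m, z, x.
pose Y := \bigcap_nk Yk nk.
have cY : cosmall Y by apply: cosmall_bigcap => nk; have [] := hYk nk.
have Ygood n m z x : config f n Y m z x -> good c f n (key c n m z x).
  move=> hc; apply: contrapT => ng.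
  have [_ /(_ ng m z x)] := hYk (n, key c n m z x).
  apply=> //; case: hc => h1 h2 h3 h4; split=> // s /h4 /(_ (n, key c n m z x) I).
  by [].
pose T := ((nat -> nat) * (nat -> bool) * (seq bool -> X))%type.
have /choice[step hstep] (nt : nat * T) : exists t : T,
    let: (m0, z0, x0) := nt.2 in let: (m, z, x) := t in
    config f nt.1 Y m0 z0 x0 ->
    config f nt.1.+1 Y m z x /\ link c nt.1 m0 z0 x0 m z x.
  case: nt => n [[m0 z0] x0] /=.
  have [hc|nc] := pselect (config f n Y m0 z0 x0); last by exists (m0, z0, x0).
  have [m [z [x hx]]] := good_extend cC cf fI (Ygood _ _ _ _ hc) cY.
  by exists (m, z, x).
have [m0 [z0 [x0 [hc0 hk0]]]] := good0 _ cY.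
pose fix st k : T := if k is k'.+1 then step (k', st k') else (m0, z0, x0).
pose M n := (st n).1.1; pose Z n := (st n).1.2; pose U n := (st n).2.
have stE n : config f n Y (M n) (Z n) (U n) /\
    link c n (M n) (Z n) (U n) (M n.+1) (Z n.+1) (U n.+1).
  have hS k : config f k Y (M k) (Z k) (U k) ->
      config f k.+1 Y (M k.+1) (Z k.+1) (U k.+1) /\
      link c k (M k) (Z k) (U k) (M k.+1) (Z k.+1) (U k.+1).
    have := hstep (k, st k); rewrite /M /Z /U /=.
    by case: (st k) => [[a1 a2] a3] /=; case: (step _) => [[b1 b2] b3]; exact.
  have hcn k : config f k Y (M k) (Z k) (U k) by elim: k => // k /hS[].
  by have [_ h] := hS _ (hcn n); split.
have hc n := (stE n).1.
pose m k := M k.+1 k.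
have Mm n k : (k < n)%N -> M n k = m k.
  elim: n => // n IH; rewrite ltnS leq_eqVlt => /orP[/eqP->//|kn].
  by have [_ [h _ _ _]] := stE n; rewrite h // IH.
have m_inc i j : (i < j)%N -> (m i < m j)%N.
  move=> ij; rewrite -(Mm j.+1 i) ?ltnS ?(ltnW ij) //.
  exact: config_lt (hc j.+1) _ _ ij (leqnSn _).
have M_ge n : (n <= M n n)%N.
  suff h k : (k <= n)%N -> (k <= M n k)%N by exact: h.
  elim: k => // k IH kn; apply: leq_ltn_trans (IH (ltnW kn)) _.
  exact: config_lt (hc n) _ _ (ltnSn k) kn.
have M_mono k l : (k <= l)%N -> (M k k <= M l l)%N.
  apply: (@homo_leq _ (fun k => M k k) leq leqnn leq_trans) => n.
  have [_ [_ h _ _]] := stE n; apply: leq_trans h _; apply: ltnW.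
  exact: config_lt (hc n.+1) _ _ (ltnSn n) (leqnn _).
pose z i := Z i.+1 i.
have Zagree k l : (k <= l)%N -> agree (M k k) (Z l) (Z k).
  elim: l => [|l IH]; first by rewrite leqn0 => /eqP->.
  rewrite leq_eqVlt ltnS => /orP[/eqP->//|kl]; apply: agree_trans (IH kl).
  have [_ [_ _ h _]] := stE l; apply: agree_le h; exact: M_mono.
have Zz n i : (i < n)%N -> Z n i = z i.
  by move=> i_n; apply: (Zagree _ _ i_n); exact: M_ge.
have spreadE n s i : (size s <= n)%N -> (i < n)%N ->
    spread (M n) (Z n) s i = embed m z (nth false s) i.
  move=> sn i_n; rewrite (@bits_spread m) ?Zz //.
  by move=> k /leq_trans/(_ sn); exact: Mm.
have m_s k : agree (m k) (embed m z (nth false (s_ k))) (nth false (s_ (m k))).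
  move=> i ik; pose n := (m k).+1.
  have km : (k <= m k)%N.
    by elim: (k) => // j IH; apply: leq_ltn_trans IH (m_inc _ _ (ltnSn j)).
  have kn : (k < n)%N by [].
  rewrite -(spreadE n) ?size_s_ ?(ltnW kn) // ?leqW //.
  by have := config_s (hc n) kn; rewrite Mm //; exact.
(* By the last clause of [link], the first [n] code coordinates of a lift are kept by all later
   stages, so the diagonal is the code of a limit lift. *)
pose code b (x : nat -> bool) i := c (U i.+1 (b :: mkseq x i.+1)) i.
have Ucode b x n : agree n (c (U n (b :: mkseq x n))) (code b x).
  elim: n => // n IH i; rewrite ltnS leq_eqVlt => /orP[/eqP->//|i_n].
  rewrite -IH //; have [_ [_ _ _ h]] := stE n.
  have := h (b :: mkseq x n) (x n); rewrite rcons_cons -mkseqS /= size_mkseq.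
  by move=> /(_ erefl i i_n).
have /choice[h hh] (bx : bool * (nat -> bool)) : exists u, c u = code bx.1 bx.2.
  by apply: cC => n; exists (U n (bx.1 :: mkseq bx.2 n)); exact: Ucode.
exists (embed m z), (fun b x => h (b, x)); split.
- exact: embed_inj.
- exact: sG0_embed.
- move=> b x; apply/funext => i; have [N hN] := cf (h (b, x)) i.+1.
  (* A stage late enough both for the continuity of [f] at the limit lift and for coordinate [i] of
     the approximation to be final. *)
  pose n := maxn N i.+1.
  have nN : (N <= n)%N := leq_maxl _ _.
  have i_n : (i < n)%N := leq_maxr N i.+1.
  rewrite -(hN (U n (b :: mkseq x n))) //; last first.
    by rewrite hh; exact: agree_le nN (Ucode b x n).
  rewrite (config_f (hc n)) ?size_mkseq //; case: i {hN} @n nN i_n => [|i] //= nN i_n.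
  rewrite spreadE ?size_mkseq // ?(ltnW i_n) //; congr (_ (+) _).
  apply: eq_in_has => k; rewrite mem_iota ltnS => /andP[_ ki].
  by rewrite nth_mkseq //; apply: leq_ltn_trans ki (ltnW i_n).
- move=> b x y n yx i i_n; rewrite !hh /code.
  have -> // : mkseq y i.+1 = mkseq x i.+1.
  by apply/mkseq_agree; exact: agree_le yx.
Qed.

End good_embedding.

(** * Minimality of the two relations *)

Section minimality.
Variables (R : realType) (Q : bool -> bool -> bool).
Hypothesis Q01 : Q false true.
Hypothesis Qneq : forall a b, Q a b -> a != b.

Lemma graph_over_minimal : minimal_non_pot_closed R (graph_over Q).
Proof.
split=> [|X S pX nS [f [fI fc fS]]]; first exact: graph_over_not_pot_closed.
have hX := polish_hausdorff pX; have [c cc] := polish_coding pX.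
have cf : ccont c f.
  move=> x n; have oU : open [set y : cantor_space | agree n y (f x)].
    by apply/cantor_openP => y yx; exists n => z /agree_trans; exact.
  have /continuousP/(_ _ oU)/(cc.2 _)/(_ x (fun i _ => erefl))[m hm] := fc.
  by exists m.
have [good0|/(not_good_cover (c := c))[B [bB iB hB]]] :=
    pselect (good c f 0 ([:: 0%N], [::], [:: [::]; [::]])).
- have [g [h [gI gG fh hc]]] := good_embedding cc.1 cf fI good0.
  pose H (x : cantor_space) : X := h (x 0%N) (shift x).
  have fH x : f (H x) = scons (x 0%N) (g (shift x)) by exact: fh.
  exists H; split.
  + move=> x y e; have : f (H x) = f (H y) by rewrite e.
    rewrite !fH => e'; rewrite -(scons_shift x) -(scons_shift y).
    have -> : x 0%N = y 0%N := congr1 (fun u : nat -> bool => u 0%N) e'.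
    by have /gI -> : g (shift x) = g (shift y) := congr1 shift e'.
  + apply/continuousP => U /cc.2 cU; apply/cantor_openP => x Ux.
    have [n hn] := cU _ Ux; exists n.+1 => y yx; apply: hn.
    rewrite /H -(yx 0%N) //; apply: hc => i i_n; exact: yx.
  + move=> x y; rewrite -fS /graph_over /= !fH /=.
    by split=> -[q /gG].
- exfalso; apply: nS.
  have cp : ccont c (fun x => shift (f x)).
    by move=> x n; have [m hm] := cf x n.+1; exists m => y /hm h i i_n; exact: h.
  (* In the refined coding the covering independent sets have clopen preimages. A pair outside [S]
     is then separated from [S] by its first bits, by [sG0_closed] if the shifts differ, or by an
     independent [B i] containing the common shift. *)
  have [d [cd dc dB]] := borel_preimages_clop hX cc cp bB.
  have df L (p : X -> nat -> L) : ccont c p -> ccont d p.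
    move=> cp' x n; have [k hk] := cp' x n; have [l hl] := dc x k.
    by exists l => y /hl/hk.
  apply: (coding_pot_closed R hX cd) => x y nSxy.
  have fS' x' y' : S (x', y') -> Q (f x' 0%N) (f y' 0%N) /\ sG0 (shift (f x')) (shift (f y')).
    by move=> /fS.
  have [Qxy|nQ] := boolP (Q (f x 0%N) (f y 0%N)); last first.
    have [n hn] := df _ _ cf x 1%N; have [k hk] := df _ _ cf y 1%N.
    exists (maxn n k) => x' y' xx yy /fS'[q _]; move/negP: nQ; apply.
    have ex := hn x' (agree_le (leq_maxl n k) xx) 0%N isT.
    have ey := hk y' (agree_le (leq_maxr n k) yy) 0%N isT.
    by rewrite -ex -ey.
  have nG : ~ sG0 (shift (f x)) (shift (f y)) by move=> h; apply: nSxy; apply/fS.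
  have [e|ne] := pselect (shift (f x) = shift (f y)); last first.
    have [l hl] := sG0_closed ne nG.
    have [n hn] := df _ _ cp x l; have [k hk] := df _ _ cp y l.
    exists (maxn n k) => x' y' xx yy /fS'[_]; apply: hl.
      by apply: hn; apply: agree_le xx; exact: leq_maxl.
    by apply: hk; apply: agree_le yy; exact: leq_maxr.
  have [i Bi] : exists i, B i (shift (f x)).
    have ex := scons_shift (f x); have ey := scons_shift (f y).
    rewrite -e in ey; move: (Qneq Qxy) ex ey.
    (* As [Q] forces different first bits, [x] and [y] are the two lifts of the common shift, in one
       order or the other. *)
    case: (f x 0%N); case: (f y 0%N) => // _ ex ey.
      exact: hB (esym ey) (esym ex).
    exact: hB (esym ex) (esym ey).
  have [n hn] := dB i x; have [k hk] := dB i y.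
  exists (maxn n k) => x' y' xx yy /fS'[_]; apply: (iB i).
    by apply/hn => //; apply: agree_le xx; exact: leq_maxl.
  by apply/hk; [apply: agree_le yy; exact: leq_maxr|rewrite /preimage /= -e].
Qed.

End minimality.

Theorem theorem7p7 (R : realType) :
  minimal_non_pot_closed R G_sG0 /\
  minimal_non_pot_closed R (symmetrization T0).
Proof.
by rewrite G_sG0E symmetrization_T0E; split; apply: graph_over_minimal => // -[] [].
Qed.
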